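(* Let $\Lambda$ and $\Gamma$ be finite graphs. If $A(\Lambda)$ embeds into $A(\Gamma)$, then $\Lambda$ is isomorphic to an induced subgraph of $\Gamma^e_k=(\Gamma^e)_k$, the clique graph of the extension graph of $\Gamma$.
   Context: A graph is a (possibly infinite) simplicial 1-complex (no loops, no multi-edges). For a graph $\Gamma$ with vertex set $V(\Gamma)$ and edge set $E(\Gamma)$, the right-angled Artin group is $A(\Gamma)=\langle V(\Gamma)\mid [v,v']=1 \text{ for each } \{v,v'\}\in E(\Gamma)\rangle$. The extension graph $\Gamma^e$ is the graph whose vertices are the elements of $A(\Gamma)$ that are conjugate to vertices of $\Gamma$ (viewed as generators), two distinct vertices being adjacent if and only if they commute in $A(\Gamma)$. A clique of a graph is a complete subgraph. The clique graph $X_k$ of a graph $X$ has as vertices the nonempty (finite) cliques of $X$, and two distinct cliques $K$ and $L$ are adjacent in $X_k$ if and only if $K$ and $L$ are both contained in some clique of $X$. A group $H$ embeds into $G$ if there is an injective homomorphism $H\to G$. *)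

(* Defs.v *)
From HB Require Import structures.
From mathcomp Require Import all_boot finmap.
From mathcomp Require Import boolp classical_sets cardinality.

Set Implicit Arguments.
Unset Strict Implicit.
Unset Printing Implicit Defensive.

Local Open Scope classical_set_scope.

(* A simplicial 1-complex, given by its vertices and its adjacency relation;
   the vertex type may be infinite or empty. *)
Record graph := Graph {
  vertex :> choiceType;
  adj : rel vertex;
  adj_sym : symmetric adj;
  adj_irr : irreflexive adj }.

Definition finite_graph (G : graph) : Prop := finite_set [set: G].

Definition isomorphic (G H : graph) : Prop :=
  exists2 f : G -> H, bijective f & {mono f : x y / adj x y}.

Section InducedSubgraph.
Variables (G : graph) (S : set G).

Definition induced_adj : rel S := [rel x y : S | adj (val x) (val y)].

Fact induced_sym : symmetric induced_adj.
Proof. by move=> x y; exact: adj_sym. Qed.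

Fact induced_irr : irreflexive induced_adj.
Proof. by move=> x; exact: adj_irr. Qed.

Definition induced_subgraph : graph := Graph induced_sym induced_irr.
End InducedSubgraph.

Section CliqueGraph.
Variable G : graph.

(* A complete subgraph is determined by its vertices, so cliques are represented
   by their vertex sets. *)
Definition clique (C : set G) : Prop :=
  forall x y, C x -> C y -> x != y -> adj x y.

Definition clique_vertices : set {fset G} :=
  [set K | K != fset0 /\ clique [set` K]].

Definition clique_adj : rel clique_vertices := [rel K L : clique_vertices | (K != L) &&
  `[< exists C : set G,
        [/\ clique C, [set` val K] `<=` C & [set` val L] `<=` C] >]].

Fact clique_adj_sym : symmetric clique_adj.
Proof.
move=> K L; rewrite /clique_adj /= eq_sym; congr (_ && _).
by apply: asbool_equiv_eq; split=> -[C [? ? ?]]; exists C.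
Qed.

Fact clique_adj_irr : irreflexive clique_adj.
Proof. by move=> K; rewrite /clique_adj /= eqxx. Qed.

Definition clique_graph : graph := Graph clique_adj_sym clique_adj_irr.
End CliqueGraph.

Section Presentation.
Variables (X : choiceType) (R : set (seq (X * bool))).

(* A letter (x, false) stands for the generator x and (x, true) for its inverse;
   a relator r in R stands for the relation r = 1. *)
Local Notation word := (seq (X * bool)).

Inductive pres_eq : word -> word -> Prop :=
| Pres_refl u : pres_eq u u
| Pres_sym u v : pres_eq u v -> pres_eq v u
| Pres_trans v u w : pres_eq u v -> pres_eq v w -> pres_eq u w
| Pres_cancel u v x b : pres_eq (u ++ (x, b) :: (x, ~~ b) :: v) (u ++ v)
| Pres_relator u v r : R r -> pres_eq (u ++ r ++ v) (u ++ v).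

Definition pres_eqb : rel word := [rel u v | `[< pres_eq u v >]].

Fact pres_eqb_refl : reflexive pres_eqb.
Proof. by move=> u; apply/asboolP; exact: Pres_refl. Qed.

Fact pres_eqb_sym : symmetric pres_eqb.
Proof. by move=> u v; apply: asbool_equiv_eq; split; exact: Pres_sym. Qed.

Fact pres_eqb_trans : transitive pres_eqb.
Proof.
by move=> v u w /asboolP uv /asboolP vw; apply/asboolP; exact: Pres_trans vw.
Qed.

Canonical pres_equiv :=
  EquivRel pres_eqb pres_eqb_refl pres_eqb_sym pres_eqb_trans.

Definition presented : Type := {eq_quot pres_eqb}%qT.

HB.instance Definition _ := Choice.on presented.

Definition class_of (w : word) : presented := (\pi_({eq_quot pres_eqb}) w)%qT.
Definition word_of (g : presented) : word := repr (g : {eq_quot pres_eqb}%qT).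

Lemma word_ofK : cancel word_of class_of.
Proof. by move=> g; exact: reprK. Qed.

Lemma class_of_eq u v : class_of u = class_of v <-> pres_eq u v.
Proof.
split=> [/eqP|uv].
  by rewrite /class_of eqmodE => /asboolP.
by apply/eqP; rewrite /class_of eqmodE; apply/asboolP.
Qed.

Lemma pres_eq_word_of w : pres_eq (word_of (class_of w)) w.
Proof. by apply/class_of_eq; rewrite word_ofK. Qed.

Definition word_inv (w : word) : word := rev [seq (a.1, ~~ a.2) | a <- w].

Lemma pres_eq_catl w u v : pres_eq u v -> pres_eq (w ++ u) (w ++ v).
Proof.
elim=> {u v}.
- by move=> u; exact: Pres_refl.
- by move=> u v _; exact: Pres_sym.
- by move=> v u t _ uv _; exact: Pres_trans.
- by move=> u v x b; rewrite !catA; exact: Pres_cancel.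
- by move=> u v r Rr; rewrite !(catA w); exact: Pres_relator.
Qed.

Lemma pres_eq_catr w u v : pres_eq u v -> pres_eq (u ++ w) (v ++ w).
Proof.
elim=> {u v}.
- by move=> u; exact: Pres_refl.
- by move=> u v _; exact: Pres_sym.
- by move=> v u t _ uv _; exact: Pres_trans.
- by move=> u v x b; rewrite -!catA; exact: Pres_cancel.
- by move=> u v r Rr; rewrite -!catA; exact: Pres_relator.
Qed.

Lemma pres_eq_cat u u' v v' :
  pres_eq u u' -> pres_eq v v' -> pres_eq (u ++ v) (u' ++ v').
Proof.
by move=> uu' vv'; apply: (Pres_trans (pres_eq_catr v uu')); exact: pres_eq_catl.
Qed.

Lemma word_invK : involutive word_inv.
Proof.
move=> w; rewrite /word_inv map_rev revK -map_comp map_id_in// => -[x b] _ /=.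
by rewrite negbK.
Qed.

Lemma pres_eq_mulwV w : pres_eq (w ++ word_inv w) [::].
Proof.
elim: w => [|[x b] w IH]; first exact: Pres_refl.
rewrite /word_inv /= rev_cons -cats1 /= catA.
have /= := pres_eq_catl [:: (x, b)] (pres_eq_catr [:: (x, ~~ b)] IH).
by move/Pres_trans; apply; exact: (Pres_cancel [::] [::]).
Qed.

Lemma pres_eq_mulVw w : pres_eq (word_inv w ++ w) [::].
Proof. by rewrite -{2}(word_invK w); exact: pres_eq_mulwV. Qed.

Definition pres_one : presented := class_of [::].
Definition pres_mul (g h : presented) : presented :=
  class_of (word_of g ++ word_of h).
Definition pres_inv (g : presented) : presented :=
  class_of (word_inv (word_of g)).

Fact pres_mulA : associative pres_mul.
Proof.
move=> g h k; apply/class_of_eq.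
apply: (Pres_trans (pres_eq_catl _ (pres_eq_word_of _))).
rewrite catA; apply: Pres_sym.
exact: (pres_eq_catr _ (pres_eq_word_of _)).
Qed.

Fact pres_mul1g : left_id pres_one pres_mul.
Proof.
move=> g; rewrite -[RHS]word_ofK; apply/class_of_eq.
exact: (pres_eq_catr _ (pres_eq_word_of [::])).
Qed.

Fact pres_mulg1 : right_id pres_one pres_mul.
Proof.
move=> g; rewrite -[RHS]word_ofK; apply/class_of_eq.
by rewrite -[X in pres_eq _ X]cats0; exact: (pres_eq_catl _ (pres_eq_word_of _)).
Qed.

Fact pres_mulVg : left_inverse pres_one pres_inv pres_mul.
Proof.
move=> g; apply/class_of_eq.
exact: (Pres_trans (pres_eq_catr _ (pres_eq_word_of _)) (pres_eq_mulVw _)).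
Qed.

Fact pres_mulgV : right_inverse pres_one pres_inv pres_mul.
Proof.
move=> g; apply/class_of_eq.
exact: (Pres_trans (pres_eq_catl _ (pres_eq_word_of _)) (pres_eq_mulwV _)).
Qed.

HB.instance Definition _ := isGroup.Build presented
  pres_mulA pres_mul1g pres_mulg1 pres_mulVg pres_mulgV.

Definition pres_gen (x : X) : presented := class_of [:: (x, false)].
End Presentation.

Section RightAngledArtinGroup.
Variable G : graph.

Definition commutator_word (v w : G) : seq (G * bool) :=
  [:: (v, false); (w, false); (v, true); (w, true)].

Definition raag_relators : set (seq (G * bool)) :=
  [set commutator_word e.1 e.2 | e in [set e : G * G | adj e.1 e.2]].

Definition raag : groupType := presented raag_relators.

Definition raag_gen (v : G) : raag := pres_gen raag_relators v.

Definition extension_vertices : set raag :=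
  [set g | exists v (h : raag), g = (raag_gen v ^ h)%g].

Definition extension_adj : rel extension_vertices :=
  [rel x y : extension_vertices | (x != y) && `[< commute (val x) (val y) >]].

Fact extension_adj_sym : symmetric extension_adj.
Proof.
move=> x y; rewrite /extension_adj /= eq_sym; congr (_ && _).
by apply: asbool_equiv_eq; split; exact: commute_sym.
Qed.

Fact extension_adj_irr : irreflexive extension_adj.
Proof. by move=> x; rewrite /extension_adj /= eqxx. Qed.

Definition extension_graph : graph := Graph extension_adj_sym extension_adj_irr.
End RightAngledArtinGroup.

Definition embeds (H G : groupType) : Prop :=
  exists f : {multiplicative H -> G}, injective f.

(* Main.v *)
Require Import Defs.
From HB Require Import structures.
From mathcomp Require Import all_boot ssralg ssrnum ssrint finmap.
From mathcomp Require Import zify.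
From mathcomp Require Import boolp classical_sets cardinality.

(* Let f embed A(Lambda) into A(Gamma).  Every element of A(Gamma) is a product
   of commuting irreducible factors, each lying in a parabolic subgroup <S>^h
   with S anticonnected (its complement graph is connected), and elements
   commute iff their factors pairwise do.  Two commuting factors either lie in
   commuting parabolics or lie in the same one and are commensurable.  So it
   suffices to replace each commensurability class by a vertex a^(u^n h) of the
   extension graph inside its parabolic: for a suitable u any two values of n
   give a pair with the same centralizer as <S>^h, so a good n avoids finitely
   many unwanted commutations.  The cliques so attached to the f(v) detect
   adjacency; for vertices v with the same star, whose images commute, v is
   first replaced by a product of powers of such vertices, chosen by Gaussian
   elimination on exponents so that the cliques become distinct.

   The group theory comes from the splittings of A(Gamma) as an HNN extension of
   <V - a> over <link a>.  As the stable letter a centralizes <link a>, this HNN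
   extension is the semidirect product of <V - a> with the free group on the
   cosets of <link a>, so that normal forms are just reduced words of a free
   group whose basis is permuted. *)

Set Implicit Arguments.
Unset Strict Implicit.
Unset Printing Implicit Defensive.

Local Open Scope group_scope.

(** * Retractions onto standard subgroups *)

Section GroupFacts.
Variable G : groupType.
Implicit Types x y z : G.

Lemma commuteP x y : commute x y <-> x ^ y = x.
Proof. by split=> [/commgP|/conjg_fixP/commgP//]; move/conjg_fixP. Qed.

Lemma commuteJ x y z : commute (x ^ z) (y ^ z) <-> commute x y.
Proof.
rewrite /commute -!conjMg; split=> [/conjg_inj//|->//].
Qed.

Lemma commuteMl x y z : commute x z -> commute y z -> commute (x * y) z.
Proof.
by move=> xz yz; apply: commute_sym; apply: commuteM; apply: commute_sym.
Qed.

Lemma commuteVl x y : commute x y -> commute x^-1 y.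
Proof. by move=> xy; apply/commute_sym/commuteV/commute_sym. Qed.

End GroupFacts.

Section Retractions.
Variable Gam : graph.
Implicit Types (v w : Gam) (A B C : pred Gam) (p : seq (Gam * bool)).
Local Notation G := (raag Gam).
Implicit Types g h : G.
Local Notation x_ := (@raag_gen Gam).
Local Notation eqw := (pres_eq (@raag_relators Gam)).

Definition gword p : G := class_of (@raag_relators Gam) p.
Local Notation cl := gword.

Lemma cl_eq p q : cl p = cl q <-> eqw p q.
Proof. exact: class_of_eq. Qed.

Lemma cl_cat p q : cl (p ++ q) = cl p * cl q.
Proof.
by apply/class_of_eq/Pres_sym/pres_eq_cat; exact: pres_eq_word_of.
Qed.

Lemma cl_nil : cl [::] = 1. Proof. by []. Qed.

Lemma cl_gen v b : cl [:: (v, b)] = if b then (x_ v)^-1 else x_ v.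
Proof.
case: b => //; apply: (@mulgI _ (x_ v)); rewrite mulgV -cl_cat.
by apply/cl_eq; exact: (Pres_cancel _ [::] [::]).
Qed.

Lemma cl_cons v b p : cl ((v, b) :: p) = (if b then (x_ v)^-1 else x_ v) * cl p.
Proof. by rewrite -cl_gen -cl_cat. Qed.

Lemma cl_inv v b : cl [:: (v, b)] * cl [:: (v, ~~ b)] = 1.
Proof. by rewrite !cl_gen; case: b; rewrite ?mulgV ?mulVg. Qed.

Lemma clP g : exists p, g = cl p.
Proof. by exists (word_of g); rewrite /gword word_ofK. Qed.

Lemma commute_gen v w : adj v w -> commute (x_ v) (x_ w).
Proof.
move=> vw; have : cl (commutator_word v w) = cl [::].
  apply/cl_eq; apply: (@Pres_relator _ _ [::] [::] (commutator_word v w)).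
  by exists (v, w).
rewrite !cl_cons cl_nil mulg1 !mulgA /=.
by move/divg1_eq/(canRL (mulgVK _)).
Qed.

Definition keep A p := [seq a <- p | A a.1].

(** Deleting letters turns a commutator relator into a relator, a cancelling pair or the empty word,
    according to which of its two generators survive. So deletion descends to the group. *)
Lemma pres_eq_keep A p q : eqw p q -> eqw (keep A p) (keep A q).
Proof.
elim=> {p q} [p|p q _|p q r _ IH1 _|p q v b|p q r [[v w] /= vw <-]].
- exact: Pres_refl.
- exact: Pres_sym.
- exact: Pres_trans.
- rewrite /keep !filter_cat /=; case: (A v); last exact: Pres_refl.
  exact: Pres_cancel.
rewrite /keep !filter_cat /=; case: (A v); case: (A w) => /=.
- have := @Pres_relator _ (@raag_relators Gam) [seq a <- p | A a.1]
    [seq a <- q | A a.1] (commutator_word v w).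
  by apply; exists (v, w).
- exact: Pres_cancel.
- exact: Pres_cancel.
exact: Pres_refl.
Qed.

Definition proj A g : G := cl (keep A (word_of g)).

Lemma proj_cl A p : proj A (cl p) = cl (keep A p).
Proof. exact/cl_eq/pres_eq_keep/pres_eq_word_of. Qed.

Fact proj_is_mul A : {morph proj A : g h / g * h}.
Proof.
move=> g h; have [p ->] := clP g; have [q ->] := clP h.
by rewrite -cl_cat !proj_cl /keep filter_cat cl_cat.
Qed.

Fact proj_is_one A : proj A 1 = 1.
Proof. exact: (proj_cl A [::]). Qed.

HB.instance Definition _ A :=
  isUMagmaMorphism.Build G G (proj A) (conj (proj_is_one A) (proj_is_mul A)).

Lemma projg1 A : proj A 1 = 1. Proof. exact: gmulf1. Qed.
Lemma projM A : {morph proj A : g h / g * h}. Proof. exact: gmulfM. Qed.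
Lemma projV A : {morph proj A : g / g^-1}. Proof. exact: gmulfV. Qed.
Lemma projJ A : {morph proj A : g h / g ^ h}. Proof. exact: gmulfJ. Qed.
Lemma projX A n : {morph proj A : g / g ^+ n}. Proof. exact: gmulfXn. Qed.

Lemma proj_proj A B g : proj A (proj B g) = proj (predI A B) g.
Proof. by have [p ->] := clP g; rewrite !proj_cl /keep -filter_predI. Qed.

Lemma eq_proj A B g : A =1 B -> proj A g = proj B g.
Proof.
move=> AB; have [p ->] := clP g; rewrite !proj_cl /keep.
by rewrite (eq_filter (fun a => AB a.1)).
Qed.

Lemma proj_gen A v : proj A (x_ v) = if A v then x_ v else 1.
Proof. by rewrite -(cl_gen v false) proj_cl /keep /=; case: ifP. Qed.

(* The standard subgroup generated by [A], as the image of the retraction. *)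
Definition Std A g : Prop := proj A g = g.

Lemma Std1 A : Std A 1. Proof. exact: projg1. Qed.

Lemma StdT g : Std predT g.
Proof. by have [p ->] := clP g; rewrite /Std proj_cl /keep filter_predT. Qed.

Lemma StdM A g h : Std A g -> Std A h -> Std A (g * h).
Proof. by move=> Ag Ah; rewrite /Std projM Ag Ah. Qed.

Lemma StdV A g : Std A g -> Std A g^-1.
Proof. by move=> Ag; rewrite /Std projV Ag. Qed.

Lemma StdVE A g : Std A g^-1 <-> Std A g.
Proof. by split=> /StdV; rewrite ?invgK. Qed.

Lemma StdX A g n : Std A g -> Std A (g ^+ n).
Proof. by move=> Ag; rewrite /Std projX Ag. Qed.

Lemma StdJ A g h : Std A g -> Std A h -> Std A (g ^ h).
Proof. by move=> Ag Ah; rewrite /Std projJ Ag Ah. Qed.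

Lemma Std_proj A g : Std A (proj A g).
Proof. by rewrite /Std proj_proj; apply: eq_proj => v /=; case: (A v). Qed.

Lemma Std_projS A B g : Std A g -> Std (predI A B) (proj B g).
Proof.
move=> Ag; rewrite /Std proj_proj -[in RHS]Ag proj_proj; apply: eq_proj => v /=.
by case: (A v); case: (B v).
Qed.

Lemma Std_sub A B g : (forall v, A v -> B v) -> Std A g -> Std B g.
Proof.
move=> AB Ag; rewrite /Std -Ag proj_proj; apply: eq_proj => v /=.
by case: (boolP (A v)) => [/AB->|]; rewrite ?andbF.
Qed.

Lemma Std_gen A v : A v -> Std A (x_ v).
Proof. by move=> Av; rewrite /Std proj_gen Av. Qed.

Lemma Std_word A g : Std A g -> exists2 p, all (fun a => A a.1) p & g = cl p.
Proof.
move=> <-; exists (keep A (word_of g)) => //; exact: filter_all.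
Qed.

Lemma Std_clP A p : all (fun a => A a.1) p -> Std A (cl p).
Proof. by move=> Ap; rewrite /Std proj_cl /keep (all_filterP Ap). Qed.

Lemma Std_ind A (P : G -> Prop) :
    P 1 -> (forall g h, P g -> P h -> P (g * h)) -> (forall g, P g -> P g^-1) ->
    (forall v, A v -> P (x_ v)) ->
  forall g, Std A g -> P g.
Proof.
move=> P1 PM PV Pg g /Std_word[p Ap ->] {g}.
elim: p Ap => [|[v b] p IH] //= /andP[Av /IH Pp].
by rewrite cl_cons; apply: PM => //; case: b; [apply: PV|]; apply: Pg.
Qed.

Lemma Std_commute_gen A g h :
  (forall v, A v -> commute h (x_ v)) -> Std A g -> commute h g.
Proof.
move=> Ah; elim/Std_ind => //; first exact: commute1.
- by move=> g1 g2; exact: commuteM.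
- by move=> g1; exact: commuteV.
Qed.

Lemma Std_commute A B g h :
  (forall v w, A v -> B w -> adj v w) -> Std A g -> Std B h -> commute g h.
Proof.
move=> AB Ag; apply: Std_commute_gen => w Bw; apply/commute_sym.
apply: Std_commute_gen Ag => v Av; apply: commute_gen.
by rewrite adj_sym AB.
Qed.

Lemma Std_pred0 A g : A =1 pred0 -> Std A g -> g = 1.
Proof.
move=> A0 <-; rewrite (eq_proj _ A0); have [p ->] := clP g.
by rewrite proj_cl /keep filter_pred0.
Qed.

(** Induction on a word: a new letter from [B] moves past the [A] part already collected.
    Irreflexivity of adjacency makes [A] and [B] disjoint, so each letter is seen by exactly one
    projection. *)
Lemma proj_split A B g : (forall v w, A v -> B w -> adj v w) ->
  Std (predU A B) g -> g = proj A g * proj B g.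
Proof.
move=> AB; have nAB v : A v -> B v = false.
  by move=> Av; apply/negbTE/negP => /(AB v v Av); rewrite adj_irr.
move=> /Std_word[p Ap ->] {g}; elim: p Ap => [|[v b] p IH] /=.
  by rewrite cl_nil !projg1 mulg1.
move=> /andP[vAB /IH {}IH]; rewrite cl_cons {1}IH !projM.
have gen C : proj C (if b then (x_ v)^-1 else x_ v) =
    if C v then (if b then (x_ v)^-1 else x_ v) else 1.
  by case: b; rewrite ?projV proj_gen; case: ifP; rewrite ?invg1.
rewrite !gen; case/orP: vAB => vAB; first by rewrite vAB nAB// mul1g mulgA.
have -> : A v = false by apply/negbTE/negP => /nAB; rewrite vAB.
rewrite vAB mul1g !mulgA; congr (_ * _).
apply: (@Std_commute B A); last exact: Std_proj.
  by move=> ? ? ? ?; rewrite adj_sym AB.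
by case: b {gen}; [apply: StdV|]; exact: Std_gen.
Qed.

(* Only finitely many generators occur in [g]. *)
Lemma Std_finite B g :
  (forall v, ~~ B v -> Std (predC1 v) g) -> Std B g.
Proof.
move=> gB; have [p gp] := clP g.
pose vs := [seq a.1 | a <- p & ~~ B a.1].
have Sg : Std [pred v | v \notin vs] g.
  have : forall v, v \in vs -> ~~ B v.
    by move=> v /mapP[a]; rewrite mem_filter => /andP[? _ ->].
  elim: vs => [|v vs IH] vsB; first by rewrite /Std gp proj_cl /keep filter_predT.
  have gv := gB v (vsB v (mem_head _ _)).
  have {}IH : Std [pred w | w \notin vs] g.
    by apply: IH => w wvs; apply: vsB; rewrite inE wvs orbT.
  rewrite /Std -[in RHS]IH -[in RHS]gv proj_proj; apply: eq_proj => w.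
  by rewrite !inE negb_or andbC.
rewrite /Std -[in RHS]Sg gp !proj_cl /keep; congr cl.
apply: eq_in_filter => a ap /=; apply/idP/idP => [Ba|].
  by apply/mapP => -[a']; rewrite mem_filter => /andP[Ba' _] aa'; rewrite aa' (negbTE Ba') in Ba.
by apply: contraR => Ba; apply: map_f; rewrite mem_filter Ba.
Qed.

End Retractions.

Arguments Std {Gam} A g.
Arguments proj {Gam} A g.

(** * Exponent sum of a generator *)

Section ExponentSum.
Import GRing.Theory.
Local Open Scope ring_scope.
Variables (Gam : graph) (t : Gam).
Local Notation G := (raag Gam).
Local Notation cl := (@gword Gam).
Local Notation x_ := (@raag_gen Gam).

Definition wexpo (p : seq (Gam * bool)) : int :=
  \sum_(a <- p) if a.1 == t then (-1) ^+ a.2 else 0.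

Lemma wexpo_cat p q : wexpo (p ++ q) = wexpo p + wexpo q.
Proof. by rewrite /wexpo big_cat. Qed.

Lemma pres_eq_wexpo p q : pres_eq (@raag_relators Gam) p q -> wexpo p = wexpo q.
Proof.
elim=> {p q} [//|p q _ ->//|p q r _ -> _ ->//|p q v b|p q r [[v w] /= vw <-]].
  rewrite !wexpo_cat /wexpo !big_cons /=; congr (_ + _); rewrite addrA.
  by case: eqP => _; case: b; rewrite /= ?expr1 ?expr0 ?subrr ?addNr add0r.
rewrite !wexpo_cat; congr (_ + _); rewrite /commutator_word /wexpo !big_cons big_nil /=.
rewrite [X in X + _ = _](_ : _ = 0) ?add0r//.
by case: (v == t); case: (w == t); rewrite ?expr0 ?expr1 ?add0r ?addr0.
Qed.

Definition expo (g : G) : int := wexpo (word_of g).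

Lemma expo_cl p : expo (cl p) = wexpo p.
Proof. exact/pres_eq_wexpo/pres_eq_word_of. Qed.

Lemma expoM g h : expo (g * h)%g = expo g + expo h.
Proof.
have [p ->] := clP g; have [q ->] := clP h.
by rewrite -cl_cat !expo_cl wexpo_cat.
Qed.

Lemma expo1 : expo 1%g = 0.
Proof. by rewrite -cl_nil expo_cl /wexpo big_nil. Qed.

Lemma expoV g : expo g^-1%g = - expo g.
Proof. by apply: (addrI (expo g)); rewrite -expoM mulgV expo1 subrr. Qed.

Lemma expoX g n : expo (g ^+ n)%g = expo g *+ n.
Proof. by elim: n => [|n IH]; rewrite ?expo1// expgS expoM IH mulrS. Qed.

Lemma expoJ g h : expo (g ^ h)%g = expo g.
Proof. by rewrite conjgE !expoM expoV addrC addrK. Qed.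

Lemma expo_gen v : expo (x_ v) = (v == t)%:R.
Proof.
by rewrite -(cl_gen v false) expo_cl /wexpo big_seq1 /=; case: ifP; rewrite ?expr0.
Qed.

Lemma expo_Std (A : pred Gam) g : ~~ A t -> Std A g -> expo g = 0.
Proof.
move=> At; elim/Std_ind => [|? ? g0 h0|? g0|v Av].
- exact: expo1.
- by rewrite expoM g0 h0 addr0.
- by rewrite expoV g0 oppr0.
by rewrite expo_gen; case: eqP Av At => // -> ->.
Qed.

End ExponentSum.

(** * Reduced words in a free group *)

Section FreeReduction.
Variable T : eqType.
Local Notation letter := (T * bool)%type.
Implicit Types (x y : letter) (u v w : seq letter).

Definition linv x : letter := (x.1, ~~ x.2).

Lemma linvK : involutive linv.
Proof. by case=> s b; rewrite /linv /= negbK. Qed.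

Definition nocancel x y := y != linv x.
Definition reduced u := sorted nocancel u.

(** Left multiplication of a reduced word by a letter, with [red] the resulting normal form in the
    free group. *)
Definition fcons x w :=
  if w is y :: w' then if y == linv x then w' else x :: w else [:: x].
Definition red w := foldr fcons [::] w.

Lemma reduced_cons x w : reduced (x :: w) -> reduced w.
Proof. exact: path_sorted. Qed.

Lemma reduced_fcons x w : reduced w -> reduced (fcons x w).
Proof.
case: w => [|y w] // rw; rewrite /fcons; case: eqP => [_|/eqP xy].
  exact: reduced_cons rw.
by rewrite /reduced /= /nocancel xy.
Qed.

Lemma reduced_red w : reduced (red w).
Proof. by elim: w => //= x w; exact: reduced_fcons. Qed.

Lemma fcons_reduced x w : reduced (x :: w) -> fcons x w = x :: w.
Proof. by case: w => [|y w] //; rewrite /reduced /= => /andP[/negbTE ->]. Qed.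

Lemma red_reduced w : reduced w -> red w = w.
Proof.
elim: w => //= x w IH xw; rewrite IH ?fcons_reduced//.
exact: reduced_cons xw.
Qed.

Lemma fconsK x w : reduced w -> fcons (linv x) (fcons x w) = w.
Proof.
case: w => [|y w] rw; rewrite /fcons ?linvK ?eqxx//.
case: eqP => [yx|_]; last by rewrite eqxx.
rewrite yx in rw *; case: w rw => [//|z w] /andP[/negbTE zx _].
by rewrite linvK in zx; rewrite zx.
Qed.

Lemma fconsVK x w : reduced w -> fcons x (fcons (linv x) w) = w.
Proof. by move=> /(fconsK (linv x)); rewrite linvK. Qed.

Lemma size_red w : (size (red w) <= size w)%N.
Proof.
elim: w => //= x w IH; apply: (@leq_trans (size (red w)).+1) => //.
by case: (red w) => //= y w'; case: ifP => /= _; lia.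
Qed.

Lemma red_catr u v : red (u ++ red v) = red (u ++ v).
Proof.
by elim: u => /= [|x u ->//]; rewrite red_reduced// reduced_red.
Qed.

Lemma red_fcons_cat x u v : red (fcons x u ++ v) = fcons x (red (u ++ v)).
Proof.
case: u => [|y u] //=; case: eqP => [->|_] //=.
by rewrite fconsVK// reduced_red.
Qed.

Lemma red_glue u m v : m != [::] ->
  reduced (u ++ m) -> reduced (m ++ v) -> reduced (u ++ m ++ v).
Proof.
case: m => [|x m] // _; rewrite /reduced; case: u => [|y u] //=.
rewrite !cat_path /= => /and3P[-> -> xm]; by rewrite !cat_path xm.
Qed.

Lemma reduced_catl u v : reduced (u ++ v) -> reduced u.
Proof. by case: u => [|x u] //; rewrite /reduced /= cat_path => /andP[]. Qed.

Lemma reduced_catr u v : reduced (u ++ v) -> reduced v.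
Proof. by elim: u => //= x u IH /reduced_cons. Qed.

Lemma reduced_rcons_cons u x y v : reduced (rcons u x) -> reduced (y :: v) ->
  y != linv x -> reduced (rcons u x ++ y :: v).
Proof.
move=> ux yv xy; rewrite cat_rcons -cat1s; apply: red_glue => //.
  by rewrite cats1.
by rewrite /reduced /= /nocancel xy.
Qed.

(** Peel off the last letter of [u]: either it cancels the first letter of [v] and induction
    applies, or the concatenation is already reduced. *)
Lemma red_cat_cancel u v : reduced u -> reduced v ->
  exists i, [/\ (i <= size u)%N, (i <= size v)%N
    & red (u ++ v) = take (size u - i) u ++ drop i v].
Proof.
elim/last_ind: u v => [|u x IH] v ru rv.
  by exists 0%N; rewrite take0 drop0 /= red_reduced.
have ru' : reduced u by move: ru; rewrite -cats1 => /reduced_catl.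
case: v rv => [|y v] rv.
  by exists 0%N; rewrite cats0 subn0 take_size cats0 red_reduced.
have [yx|yx] := eqVneq y (linv x).
  have [i [iu iv e]] := IH v ru' (reduced_cons rv).
  exists i.+1; rewrite size_rcons /=; split; [lia|lia|].
  rewrite subSS -cats1 takel_cat ?leq_subr// -e -catA /= yx.
  by rewrite -red_catr /= fconsVK ?reduced_red// red_catr.
exists 0%N; split=> //; rewrite subn0 take_size drop0 red_reduced//.
exact: reduced_rcons_cons.
Qed.

Section Equivariance.
Variable f : T -> T.
Hypothesis f_inj : injective f.
Definition lmap x : letter := (f x.1, x.2).

Lemma lmap_inj : injective lmap.
Proof. by move=> [s b] [s' b'] [/f_inj -> ->]. Qed.

Lemma lmap_linv x : lmap (linv x) = linv (lmap x). Proof. by []. Qed.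

Lemma map_fcons x w : map lmap (fcons x w) = fcons (lmap x) (map lmap w).
Proof.
by case: w => [|y w] //=; rewrite -lmap_linv (inj_eq lmap_inj); case: ifP.
Qed.

Lemma map_red w : map lmap (red w) = red (map lmap w).
Proof. by elim: w => //= x w IH; rewrite map_fcons IH. Qed.

Lemma reduced_map w : reduced w -> reduced (map lmap w).
Proof. by move=> rw; rewrite -(red_reduced rw) map_red reduced_red. Qed.

End Equivariance.

Lemma reduced_pos w : all (fun x => ~~ x.2) w -> reduced w.
Proof.
elim: w => [|[s b] w IH] //= /andP[nb wp]; case: w wp IH => [|[s' b'] w] //=.
case/andP=> nb' wp IH; rewrite /reduced /= [path _ _ _]IH ?nb'// andbT.
by rewrite /nocancel /linv xpair_eqE /= (negbTE nb) (negbTE nb') andbF.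
Qed.

End FreeReduction.

(** * The action on the tree of a vertex *)

Section TreeAction.
Variables (Gam : graph) (a : Gam).
Implicit Types (v w : Gam) (A B : pred Gam) (p q : seq (Gam * bool)).
Local Notation G := (raag Gam).
Implicit Types g h k z : G.
Implicit Types S : set G.
Local Notation cl := (@gword Gam).
Local Notation x_ := (@raag_gen Gam).
Local Notation eqw := (pres_eq (@raag_relators Gam)).

Local Notation pi_ := (proj (predC1 a)).
Local Notation H := (Std (predC1 a)).
Local Notation L := (Std (adj a)).
Local Notation letter := (set G * bool)%type.
Implicit Types (x : letter) (y : seq letter).

(** Cosets are kept as subsets of the group, so that no representatives have to be chosen and
    translation acts on them directly. *)
Definition tr g S : set G := [set h | S (g^-1 * h)]%classic.

Lemma trM g h S : tr (g * h) S = tr g (tr h S).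
Proof. by apply/funext => k; rewrite /tr /= invgM mulgA. Qed.

Lemma tr1 S : tr 1 S = S.
Proof. by apply/funext => k; rewrite /tr /= invg1 mul1g. Qed.

Lemma tr_inj g : injective (tr g).
Proof.
by move=> S S' SS'; rewrite -[S]tr1 -[S']tr1 -(mulVg g) !trM SS'.
Qed.

Definition L0 : set G := [set h | L h]%classic.

Lemma tr_L g : L g -> tr g L0 = L0.
Proof.
move=> Lg; apply/funext => k; rewrite /tr /L0 /=; apply/propext; split=> Lk.
  by rewrite -(mulVKg g k); apply: StdM => //.
by apply: StdM => //; apply: StdV.
Qed.

Lemma tr_fixL g u : tr g (tr u L0) = tr u L0 -> L (g ^ u).
Proof.
move=> e; have : tr (g ^ u) L0 = L0 by rewrite conjgE !trM e -trM mulVg tr1.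
move/(congr1 (fun S : set G => S 1)); rewrite /tr /L0 /= mulg1 => e1.
by apply/StdVE; rewrite e1; apply: Std1.
Qed.

Definition lt g := lmap (tr g).

Lemma lt1 : lt 1 =1 id. Proof. by case=> S b; rewrite /lt /lmap /= tr1. Qed.
Lemma ltM g h x : lt (g * h) x = lt g (lt h x).
Proof. by rewrite /lt /lmap /= trM. Qed.

Lemma map_ltM g h y : map (lt (g * h)) y = map (lt g) (map (lt h) y).
Proof. by rewrite -map_comp; apply: eq_map => x; rewrite ltM. Qed.

Lemma map_lt1 y : map (lt 1) y = y.
Proof. by rewrite (eq_map lt1) map_id. Qed.

(* The group acts on the Cayley tree of the free group on the cosets [g L]:
   generators other than [a] permute the cosets and [a] multiplies on the left
   by the letter [L]. *)
Definition step (l : Gam * bool) y :=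
  if l.1 == a then fcons (L0, l.2) y else map (lt (cl [:: l])) y.

Definition actw p y := foldr step y p.

Lemma actw_cat p q y : actw (p ++ q) y = actw p (actw q y).
Proof. exact: foldr_cat. Qed.

Lemma reduced_step l y : reduced y -> reduced (step l y).
Proof.
move=> ry; rewrite /step; case: ifP => _; first exact: reduced_fcons.
exact: (reduced_map (@tr_inj _)).
Qed.

Lemma reduced_actw p y : reduced y -> reduced (actw p y).
Proof. by move=> ry; elim: p => //= l p; exact: reduced_step. Qed.

Lemma stepK v b y : reduced y -> step (v, b) (step (v, ~~ b) y) = y.
Proof.
move=> ry; rewrite /step /=; case: (v == a); first exact: (fconsVK (L0, b)).
by rewrite -map_ltM cl_inv map_lt1.
Qed.

Lemma map_lt_fcons g x y : map (lt g) (fcons x y) = fcons (lt g x) (map (lt g) y).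
Proof. exact: (map_fcons (@tr_inj _)). Qed.

Lemma lt_L0 g b : L g -> lt g (L0, b) = (L0, b).
Proof. by move=> Lg; rewrite /lt /lmap /= tr_L. Qed.

Lemma L_gen v b : adj a v -> L (cl [:: (v, b)]).
Proof. by move=> av; apply: Std_clP; rewrite /= av. Qed.

(** If [a] occurs in the commutator, the other generator lies in [L], fixes the letter [L0] and so
    passes through it. Otherwise the commutator acts by translation by a trivial group element. *)
Lemma actw_comm v w y : adj v w -> reduced y ->
  actw (commutator_word v w) y = y.
Proof.
have aux b c u y' : adj a u -> reduced y' ->
    step (u, b) (step (a, c) (step (u, ~~ b) y')) = step (a, c) y'.
  move=> au ry; rewrite /step /= eqxx; case: eqP => [ua|_].
    by rewrite ua adj_irr in au.
  rewrite map_lt_fcons lt_L0; last exact: L_gen.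
  by rewrite -map_ltM cl_inv map_lt1.
move=> vw ry; rewrite /commutator_word /=.
have [va|va] := eqVneq v a.
  rewrite va in vw *; rewrite (aux false true w y vw ry).
  exact: (stepK a false).
have [wa|wa] := eqVneq w a.
  rewrite wa adj_sym in vw *.
  rewrite (aux false false v _ vw (reduced_step _ ry)).
  exact: (stepK a false).
rewrite /step /= (negbTE va) (negbTE wa) -!map_ltM -!cl_cat.
rewrite (_ : cl _ = 1) ?map_lt1//; apply/cl_eq.
apply: (@Pres_relator _ _ [::] [::] (commutator_word v w)).
by exists (v, w).
Qed.

Lemma pres_eq_actw p q y : eqw p q -> reduced y -> actw p y = actw q y.
Proof.
move=> pq ry; elim: pq => {p q} [//|p q _ ->//|p q r _ -> _ ->//|p q v b|].
  by rewrite !actw_cat /= stepK// reduced_actw.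
move=> p q r [[v w] /= vw <-]; rewrite !actw_cat actw_comm// reduced_actw//.
Qed.

Definition act g y := actw (word_of g) y.

Lemma act_cl p y : reduced y -> act (cl p) y = actw p y.
Proof. exact/pres_eq_actw/pres_eq_word_of. Qed.

Lemma reduced_act g y : reduced y -> reduced (act g y).
Proof. exact: reduced_actw. Qed.

Lemma actM g h y : reduced y -> act (g * h) y = act g (act h y).
Proof.
move=> ry; have [p ->] := clP g; have [q ->] := clP h.
by rewrite -cl_cat !act_cl// ?actw_cat// reduced_actw.
Qed.

Lemma act_H g y : H g -> reduced y -> act g y = map (lt g) y.
Proof.
move=> /Std_word[p Hp ->] ry; rewrite act_cl// {g}.
elim: p Hp => [|[v b] p IH] /=; first by rewrite cl_nil map_lt1.
move=> /andP[va /IH ->]; rewrite /step /= (negbTE va) -map_ltM -cl_cat //.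
Qed.

(** The free-group component of [g] in the semidirect product, or the path from the base vertex of
    the tree to its image under [g]. It is a cocycle twisted by [pi_]. *)
Definition coc g := act g [::].

Lemma reduced_coc g : reduced (coc g). Proof. exact: reduced_act. Qed.
Hint Resolve reduced_coc : core.

Lemma cocM g h : coc (g * h) = act g (coc h).
Proof. exact: actM. Qed.

Lemma coc_H g : H g -> coc g = [::].
Proof. by move=> Hg; rewrite /coc act_H. Qed.

Lemma coc1 : coc 1 = [::]. Proof. exact/coc_H/Std1. Qed.

Lemma actE g y : reduced y -> act g y = red (coc g ++ map (lt (pi_ g)) y).
Proof.
move=> ry; have [p ->] := clP g; rewrite /coc !act_cl//.
elim: p => [|[v b] p IH] /=; first by rewrite cl_nil projg1 map_lt1 red_reduced.
rewrite IH -[(v, b) :: p]cat1s cl_cat projM /step /=; case: eqP => [->|/eqP va].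
  rewrite red_fcons_cat (proj_cl _ [:: _]) /keep /= eqxx /= cl_nil mul1g//.
rewrite (proj_cl _ [:: _]) /keep /= va map_ltM (map_red (@tr_inj _)) map_cat.
by [].
Qed.

Lemma cocME g h : coc (g * h) = red (coc g ++ map (lt (pi_ g)) (coc h)).
Proof. by rewrite cocM actE. Qed.

Lemma coc_letter g x : x \in coc g -> exists2 u, H u & x.1 = tr u L0.
Proof.
have [p ->] := clP g; rewrite /coc act_cl//.
elim: p x => [|[v b] p IH] x //=; rewrite /step /=; case: eqP => [_|/eqP va].
  have : {subset fcons (L0, b) (actw p [::]) <= (L0, b) :: actw p [::]}.
    case: (actw p [::]) => [|y0 y'] //= t; case: ifP => // _ ty.
    by rewrite !inE ty !orbT.
  move=> sub /sub; rewrite inE => /orP[/eqP ->|/IH//].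
  by exists 1; [exact: Std1|rewrite /= tr1].
case/mapP=> x' /IH[u Hu ux'] ->; exists (cl [:: (v, b)] * u).
  by apply: StdM => //; apply: Std_clP; rewrite /= va.
by rewrite /= ux' trM.
Qed.

(* The inverse of the isomorphism onto the semidirect product: a coset [u L]
   evaluates to the conjugate [a ^ u^-1], which depends on the coset only. *)
Definition evl x : G :=
  if pselect (exists u, x.1 = tr u L0) is left e
  then cl [:: (a, x.2)] ^ (projT1 (cid e))^-1 else 1.

Lemma evlE u b : evl (tr u L0, b) = cl [:: (a, b)] ^ u^-1.
Proof.
rewrite /evl; case: pselect => [e|[]]; last by exists u.
case: (cid e) => w /= uw.
have Lwu : L (u^-1 * w).
  have : tr w L0 w by rewrite /tr /L0 /= mulVg; exact: Std1.
  by rewrite -uw.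
apply: (@conjg_inj _ w); rewrite -conjgM mulVg conjg1 -conjgM.
apply/esym/commuteP; apply: Std_commute_gen Lwu => v av.
by rewrite cl_gen; case: (b); [apply: commuteVl|]; apply: commute_gen.
Qed.

Definition ev y : G := \prod_(x <- y) evl x.

Lemma ev_map g y : (forall x, x \in y -> exists u, x.1 = tr u L0) ->
  ev (map (lt g) y) = ev y ^ g^-1.
Proof.
elim: y => [|[S b] y IH] yL; first by rewrite /ev !big_nil conj1g.
rewrite /ev /= !big_cons conjMg -IH; last by move=> x xy; apply: yL; rewrite inE xy orbT.
congr (_ * _); have [/= u ->] := yL _ (mem_head _ _).
by rewrite /lt /lmap /= -trM !evlE invgM conjgM.
Qed.

Lemma ev_fcons x y : (exists u, x.1 = tr u L0) ->
  ev (fcons x y) = evl x * ev y.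
Proof.
case: x => S b [/= u ->]; case: y => [|x' y] /=; first by rewrite /ev !big_cons.
case: eqP => [->|_]; rewrite /ev !big_cons // mulgA /linv /= !evlE -conjMg.
by rewrite !cl_gen; case: b; rewrite ?mulgV ?mulVg conj1g mul1g.
Qed.

(** Recovers [g] from its two components. Hence an empty cocycle forces [g] into [H]: the stabilizer
    of the base vertex is exactly [H]. *)
Lemma ev_coc g : g = ev (coc g) * pi_ g.
Proof.
have [p ->] := clP g; rewrite /coc act_cl//.
elim: p => [|[v b] p IH] /=; first by rewrite cl_nil projg1 mulg1 /ev big_nil.
rewrite -[(v, b) :: p]cat1s cl_cat {1}IH projM /step /=; case: eqP => [->|/eqP va].
  rewrite ev_fcons; last by exists 1; rewrite tr1.
  by rewrite -[L0]tr1 evlE invg1 conjg1 (proj_cl _ [:: _]) /keep /= eqxx cl_nil mul1g mulgA.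
rewrite ev_map; last first.
  move=> x xp; have := @coc_letter (cl p) x; rewrite /coc act_cl// => /(_ xp)[u _ ->].
  by exists u.
by rewrite (proj_cl _ [:: _]) /keep /= va conjgE invgK -!mulgA mulKg.
Qed.

Lemma coc_nil g : coc g = [::] -> H g.
Proof.
by move=> g0; have := ev_coc g; rewrite g0 /ev big_nil mul1g => ->; exact: Std_proj.
Qed.

Lemma coc_eq g h : coc g = coc h -> H (g^-1 * h).
Proof.
by move=> gh; apply: coc_nil; rewrite cocM -gh -cocM mulVg coc1.
Qed.

(** Apply [coc] to [g * h = h * g ^ h]: on the left [g] translates every letter of [coc h], on the
    right [g ^ h] contributes nothing. *)
Lemma coc_fix g h x : H g -> H (g ^ h) -> x \in coc h -> tr g x.1 = x.1.
Proof.
move=> Hg Hgh; have : map (lt g) (coc h) = map id (coc h).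
  rewrite map_id -act_H// -cocM.
  by rewrite [g * h]conjgC cocM (coc_H Hgh).
by move/eq_in_map => e /e {2}<-.
Qed.

(** An element fixing both the base vertex and its distinct image under [h] fixes an edge between
    them, and edge stabilizers are conjugates of [L]. *)
Lemma tree_fix g h : H g -> H (g ^ h) -> ~ H h -> exists u, L (g ^ u).
Proof.
move=> Hg Hgh; case e : (coc h) => [|x y] Hh; first by case: Hh; exact: coc_nil.
have xh : x \in coc h by rewrite e mem_head.
have [u Hu xu] := coc_letter xh; exists u; apply: tr_fixL.
by rewrite -xu; exact: coc_fix xh.
Qed.

Definition pos (s : seq Gam) : G := cl [seq (v, false) | v <- s].

Lemma pos_cat s t : pos (s ++ t) = pos s * pos t.
Proof. by rewrite /pos map_cat cl_cat. Qed.

Lemma pos1 v : pos [:: v] = x_ v. Proof. by []. Qed.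

Lemma coc_pos s : all (fun x => ~~ x.2) (coc (pos s)).
Proof.
elim: s => [|v s IH]; first by rewrite /pos /= cl_nil coc1.
rewrite -cat1s pos_cat cocM /pos /= act_cl//= /step /=; case: eqP => _.
  by rewrite fcons_reduced; [rewrite /= IH|apply: reduced_pos; rewrite /= IH].
by rewrite all_map.
Qed.

Lemma coc_pos_cat s t :
  coc (pos s * pos t) = coc (pos s) ++ map (lt (pi_ (pos s))) (coc (pos t)).
Proof.
rewrite cocME red_reduced//; apply: reduced_pos.
by rewrite all_cat all_map !coc_pos.
Qed.

(* A positive word admits no cancellation in the tree, so every [a]-edge it
   crosses is fixed. *)
Lemma tree_pos z s t :
  H z -> H (z ^ pos (s ++ a :: t)) -> L (z ^ pos s).
Proof.
move=> Hz; rewrite pos_cat => Hzu.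
have fixz := coc_fix Hz Hzu; rewrite coc_pos_cat in fixz.
(* The path of [pos s] is a prefix of a path fixed letter by letter, so [z] fixes its endpoint
   too. *)
have Hzs : H (z ^ pos s).
  apply: coc_nil; rewrite conjgE cocM cocM (act_H Hz)//.
  rewrite (_ : map _ _ = coc (pos s)) -?cocM ?mulVg ?coc1//.
  rewrite -[RHS]map_id; apply/eq_in_map => x xs; rewrite /lt /lmap fixz; first by case: x {xs}.
  by rewrite mem_cat xs.
(* The letter following this prefix is the [a]-edge, the coset of [L] translated by [pi_ (pos s)].
   That [z] fixes it is the claim. *)
suff : L (z ^ pi_ (pos s)).
  by move=> Lz; rewrite -[z ^ pos s]Hzs projJ Hz.
apply: tr_fixL; apply: (fixz (tr (pi_ (pos s)) L0, false)).
rewrite mem_cat; apply/orP; right; apply/mapP; exists (L0, false) => //.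
rewrite -cat1s pos_cat coc_pos_cat mem_cat pos1 -(cl_gen a false) /coc act_cl//=.
by rewrite /step /= eqxx mem_head.
Qed.

End TreeAction.

(** * Hyperbolic elements *)

Section HyperbolicElements.
Variables (Gam : graph) (a : Gam).
Local Notation G := (raag Gam).
Implicit Types g h k z : G.
Local Notation cl := (@gword Gam).
Local Notation pi_ := (proj (predC1 a)).
Local Notation H := (Std (predC1 a)).
Local Notation coc := (coc a).
Local Notation lt := (@lt Gam).
Hint Resolve reduced_coc : core.

(** The conjugates of [H] are the vertex stabilizers, so this says that [k] fixes no vertex of the
    tree of [a]. *)
Definition hyperbolic k := forall h, ~ H (k ^ h).

Lemma hyperbolicJ k h : hyperbolic k -> hyperbolic (k ^ h).
Proof. by move=> hk g; rewrite -conjgM. Qed.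

Lemma coc_conj_gen u b :
  H u -> coc (cl [:: (a, b)] ^ u^-1) = [:: (tr u (L0 a), b)].
Proof.
move=> Hu; rewrite conjgE invgK !cocM (coc_H (StdV Hu)) act_cl// act_H//.
  by rewrite /= /step /= eqxx.
by rewrite /= /step /= eqxx.
Qed.

Lemma pi_conj_gen u b : pi_ (cl [:: (a, b)] ^ u) = 1.
Proof. by rewrite projJ proj_cl /keep /= eqxx cl_nil conj1g. Qed.

(** No cancellation occurs in the word of [k * k]. The second copy is twisted by [pi_ k], as in
    [cocME]. *)
Definition cyc_reduced k := reduced (coc k ++ map (lt (pi_ k)) (coc k)).

Lemma reduced_lt g y : reduced y -> reduced (map (lt g) y).
Proof. exact: (reduced_map (@tr_inj _ _)). Qed.

Lemma red_cancel_mid (T : eqType) (u v : seq (T * bool)) x :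
  red (u ++ x :: linv x :: v) = red (u ++ v).
Proof. by rewrite -red_catr /= fconsVK ?reduced_red// red_catr. Qed.

(** When the condition fails, the last letter of [coc k] cancels the twisted first letter, and
    conjugating by the element with one-letter word [x] removes both. Induction on length ends
    because hyperbolicity excludes the empty word, and a single letter cannot cancel its twist,
    which has the same sign. *)
Lemma cyc_reduction k : hyperbolic k -> exists h, cyc_reduced (k ^ h).
Proof.
have [n] := ubnP (size (coc k)); elim: n k => // n IH k kn hk.
have [?|nr] := pselect (cyc_reduced k); first by exists 1; rewrite conjg1.
case e : (coc k) => [|x w].
  by case: (hk 1); rewrite conjg1; exact: (coc_nil e).
case/lastP: w e => [|w y] e.
  case: nr; rewrite /cyc_reduced e /= /reduced /= /nocancel andbT.
  by apply/eqP => -[_]; case: x.2.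
have rk : reduced (x :: rcons w y) by rewrite -e.
have xy : lt (pi_ k) x = linv y.
  apply/eqP; apply: contrapT => xy; apply: nr; rewrite /cyc_reduced e.
  rewrite -rcons_cons; apply: (@reduced_rcons_cons _ _ _ (lt (pi_ k) x)) => //.
    exact: (@reduced_lt _ (x :: rcons w y)).
  exact/negP.
have xk : x \in coc k by rewrite e mem_head.
have [u Hu xu] := coc_letter xk.
pose g := cl [:: (a, x.2)] ^ u^-1.
have cg : coc g = [:: x] by rewrite coc_conj_gen// -xu; case: (x).
have gV : g^-1 = cl [:: (a, ~~ x.2)] ^ u^-1.
  by rewrite -conjVg !cl_gen; congr (_ ^ _); case: x.2; rewrite ?invgK.
have cgV : coc g^-1 = [:: linv x] by rewrite gV coc_conj_gen// /linv -xu.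
have e' : coc (k ^ g) = w.
  have rw : reduced w by move: rk; rewrite -cats1 => /reduced_cons/reduced_catl.
  have ekg : coc (k * g) = fcons x w.
    rewrite cocME cg e [map _ _]/= xy -cat1s -catA -red_catr cat_rcons.
    by rewrite red_cancel_mid cats0 (red_reduced rw) /= (red_reduced rw).
  by rewrite conjgE cocME cgV gV pi_conj_gen map_lt1 ekg /= red_reduced ?fconsK// reduced_fcons.
have kgn : (size (coc (k ^ g)) < n)%N.
  by move: kn; rewrite e e' /= size_rcons; lia.
have [h hg] := IH (k ^ g) kgn (@hyperbolicJ _ g hk).
by exists (g * h); rewrite conjgM.
Qed.

(** * Translation along the axis of a cyclically reduced element *)

Section Axis.
Variable k : G.
Hypotheses (k_red : cyc_reduced k) (k_nil : coc k <> [::]).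

Local Notation W n := (coc (k ^+ n)).
Local Notation l := (size (coc k)).

Let l_gt0 : (0 < l)%N. Proof. by rewrite lt0n size_eq0; exact/eqP. Qed.

Lemma coc_expg n : W n.+1 = W n ++ map (lt (pi_ k ^+ n)) (coc k).
Proof.
rewrite expgSr cocME projX red_reduced//.
elim: n => [|n IH]; first by rewrite !expg0 coc1 map_lt1; exact: reduced_coc.
rewrite expgSr cocME projX (red_reduced IH) -catA; apply: red_glue => //.
  by rewrite -size_eq0 size_map size_eq0; exact/eqP.
by rewrite [_ ^+ n.+1]expgSr map_ltM -map_cat; exact: reduced_lt.
Qed.

Lemma coc_expgD n m : W (n + m) = W n ++ map (lt (pi_ k ^+ n)) (W m).
Proof.
elim: m => [|m IH]; first by rewrite addn0 expg0 coc1 cats0.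
by rewrite addnS !coc_expg map_cat catA -IH (expgnDr (pi_ k)) map_ltM.
Qed.

Lemma size_coc_expg n : size (W n) = (n * l)%N.
Proof. by elim: n => [|n IH]; rewrite ?coc1// coc_expg size_cat size_map IH mulSn addnC. Qed.

Section Centralizer.
Variable h : G.
Hypothesis hk : commute h k.
Local Notation N := (size (coc h)).
Local Notation C M := (coc (h * k ^+ M)).

(** At most [N] letters of [W M] cancel against [h]. As [M] exceeds [N], some letter of [W M]
    survives and shields the later powers. *)
Lemma coc_centralizerD M q : (N < M)%N ->
  C (M + q) = C M ++ map (lt (pi_ (h * k ^+ M))) (W q).
Proof.
move=> NM; rewrite expgnDr mulgA [LHS]cocME red_reduced//.
have rW : reduced (map (lt (pi_ h)) (W M)) by exact: reduced_lt.
have [i [iN iM e]] := red_cat_cancel (reduced_coc a h) rW.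
have eC : C M = take (N - i) (coc h) ++ drop i (map (lt (pi_ h)) (W M)).
  by rewrite cocME e.
rewrite eC -catA; apply: red_glue.
- rewrite -size_eq0 size_drop size_map size_coc_expg -lt0n subn_gt0.
  by apply: (leq_ltn_trans iN); rewrite (leq_trans NM)// leq_pmulr.
- by rewrite -eC.
have := reduced_lt (pi_ h) (reduced_coc a (k ^+ (M + q))).
rewrite coc_expgD map_cat -map_ltM projM projX.
rewrite -{1}(cat_take_drop i (map (lt (pi_ h)) (W M))) -catA.
exact: reduced_catr.
Qed.

Lemma size_coc_centralizer M q : (N < M)%N ->
  size (C (M + q)) = (size (C M) + q * l)%N.
Proof.
by move=> NM; rewrite coc_centralizerD// size_cat size_map size_coc_expg.
Qed.

(** Write the element with [h] on the right instead: then only the last [N] letters of [W (M + n)]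
    can be disturbed. The slack [N.*2] covers these and the up to [N] letters by which [C M] may
    exceed [W M]. *)
Lemma coc_centralizer_take M n : (N < M)%N -> (N.*2 <= n)%N ->
  C M = take (size (C M)) (W (M + n)).
Proof.
move=> NM Nn.
have sC : (size (C M) <= N + M * l)%N.
  rewrite cocME; apply: (leq_trans (size_red _)).
  by rewrite size_cat size_map size_coc_expg.
have : C (M + n) = coc (k ^+ (M + n) * h) by congr coc; exact/commuteX.
rewrite coc_centralizerD//.
have [i [_ iN e]] := red_cat_cancel (reduced_coc a (k ^+ (M + n)))
  (reduced_lt (pi_ (k ^+ (M + n))) (reduced_coc a h)).
rewrite [RHS]cocME [RHS]e => /(congr1 (take (size (C M)))); rewrite take_size_cat// => {1}->.
rewrite size_map in iN.
have sM : (size (C M) <= size (W (M + n)) - i)%N.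
  rewrite size_coc_expg mulnDl.
  have nl : (n <= n * l)%N by rewrite leq_pmulr.
  have aux c N' m r i' : (c <= N' + m -> i' <= N' -> N'.*2 <= n -> n <= r -> c <= m + r - i')%N.
    by lia.
  exact: aux sC iN Nn nl.
by rewrite takel_cat ?size_takel ?leq_subr// take_takel.
Qed.

End Centralizer.

(** Each [h ^+ j * k ^+ M] has as word a prefix of a long power of [k], determined by its length.
    Among [l + 1] exponents [j], two lengths agree modulo [l]; a suitable power of [k] makes the
    words equal, and the quotient then fixes the base vertex. *)
Lemma axis_commute h : commute h k ->
  exists i q, (0 < i)%N /\ (H (h ^+ i * k ^+ q) \/ H (h ^+ i * k ^- q)).
Proof.
move=> hk; have hjk j : commute (h ^+ j) k by apply/commute_sym/commuteX/commute_sym.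
(* This [M] exceeds the word lengths of all [h ^+ j] with [j <= l], so the prefix description
   applies to each of them. *)
pose M := (\max_(j < l.+1) size (coc (h ^+ j))).+1.
have NM (j : 'I_l.+1) : (size (coc (h ^+ j)) < M)%N by exact: leq_bigmax.
pose c (j : nat) := size (coc (h ^+ j * k ^+ M)).
pose f (j : 'I_l.+1) : 'I_l := Ordinal (ltn_pmod (c j) l_gt0).
have [j1 [j2 [j12 cj]]] : exists j1 j2 : 'I_l.+1, (j1 < j2)%N /\ c j1 = c j2 %[mod l].
  have /injectivePn [j1 [j2 j12 /(congr1 val)/= fj]] : ~~ injectiveb f.
    by apply/negP => /injectiveP/leq_card; rewrite !card_ord ltnn.
  move: j12; rewrite neq_ltn => /orP[j12|j12]; first by exists j1, j2.
  by exists j2, j1.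
(* Both words are prefixes of [W (M + q + n)], and the hypothesis makes their lengths equal. *)
have key (i1 i2 : 'I_l.+1) q : c i1 = (c i2 + q * l)%N ->
    coc (h ^+ i1 * k ^+ M) = coc (h ^+ i2 * k ^+ (M + q)).
  move=> e; pose n := maxn (size (coc (h ^+ i1))).*2 (size (coc (h ^+ i2))).*2.
  rewrite (@coc_centralizer_take _ (hjk i1) M (q + n))//; last first.
    by rewrite /n; lia.
  rewrite (@coc_centralizer_take _ (hjk i2) (M + q) n)//; last 2 first.
  - by rewrite (leq_trans (NM i2)) ?leq_addr.
  - by rewrite /n; lia.
  by rewrite size_coc_centralizer// -/(c i1) -/(c i2) -e addnA.
have i_gt0 : (0 < j2 - j1)%N by rewrite subn_gt0.
have hj : h ^+ j2 = h ^+ j1 * h ^+ (j2 - j1) by rewrite -expgnDr subnKC// ltnW.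
have hkX i n : commute (h ^+ i) (k ^+ n) by exact: commuteX2.
have grp1 (x y K Q : G) : commute y K ->
    (x * K)^-1 * (x * y * (K * Q)) = y * Q.
  by move=> yK; rewrite invgM -!mulgA mulKg (mulgA y) yK -mulgA mulKg.
have grp2 (x y K Q : G) : commute y K -> commute y Q ->
    (x * (K * Q))^-1 * (x * y * K) = y * Q^-1.
  by move=> yK /commuteV yQ; rewrite !invgM -!mulgA mulKg yK mulKg yQ.
have [le12|/ltnW le21] := leqP (c j1) (c j2).
  have /divnK e : (l %| c j2 - c j1)%N by rewrite -eqn_mod_dvd// eq_sym; apply/eqP.
  exists (j2 - j1)%N, ((c j2 - c j1) %/ l)%N; split=> //; right.
  have := key j2 j1 ((c j2 - c j1) %/ l)%N; rewrite e subnKC// => /(_ erefl)/esym.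
  by move/coc_eq; rewrite hj expgnDr grp2.
have /divnK e : (l %| c j1 - c j2)%N by rewrite -eqn_mod_dvd//; apply/eqP.
exists (j2 - j1)%N, ((c j1 - c j2) %/ l)%N; split=> //; left.
have := key j1 j2 ((c j1 - c j2) %/ l)%N; rewrite e subnKC// => /(_ erefl).
by move/coc_eq; rewrite hj expgnDr grp1.
Qed.

End Axis.

Lemma cyc_reduced_nil k : hyperbolic k -> coc k <> [::].
Proof. by move=> /(_ 1) hk /coc_nil; rewrite -(conjg1 k). Qed.

Lemma hyperbolic_expg k n : hyperbolic k -> (0 < n)%N -> k ^+ n <> 1.
Proof.
move=> hk n0; have [h hr] := cyc_reduction hk => k1.
have hkh := cyc_reduced_nil (hyperbolicJ (h := h) hk).
have /eqP := size_coc_expg hr hkh n.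
rewrite -conjXg k1 conj1g coc1 /= eq_sym muln_eq0 -leqn0 leqNgt n0 /= size_eq0.
by move/eqP.
Qed.

Lemma hyperbolic_commute h k : hyperbolic k -> commute h k ->
  exists i q g, (0 < i)%N /\ (H ((h ^+ i * k ^+ q) ^ g) \/ H ((h ^+ i * k ^- q) ^ g)).
Proof.
move=> hk hk'; have [g gr] := cyc_reduction hk.
have [] := axis_commute gr (cyc_reduced_nil (hyperbolicJ (h := g) hk)) (h := h ^ g).
  exact/commuteJ.
move=> i [q [i0]]; rewrite -!conjXg -conjVg -!conjMg => Hiq.
by exists i, q, g.
Qed.

End HyperbolicElements.

(** * Supports, centralizers and components *)

Section Supports.
Variable Gam : graph.
Implicit Types (a v w : Gam) (A B C : pred Gam) (S : {fset Gam}).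
Local Notation G := (raag Gam).
Implicit Types e g h k l u x z : G.
Local Notation x_ := (@raag_gen Gam).

Definition link A : pred Gam := [pred v | `[< forall a, A a -> adj a v >]].

Lemma linkP A v : reflect (forall a, A a -> adj a v) (link A v).
Proof. exact: asboolP. Qed.

Definition closed_star A : pred Gam := predU A (link A).

Lemma link_disjoint A a : A a -> ~~ link A a.
Proof. by move=> Aa; apply/negP => /linkP/(_ a Aa); rewrite adj_irr. Qed.

(* [k] has support exactly [A] in the minimal, conjugation invariant sense. *)
Definition full A k := Std A k /\ forall a, A a -> hyperbolic a k.

Lemma full_conj_Std A k h a : full A k -> A a -> ~ Std (predC1 a) (k ^ h).
Proof. by move=> [_ hk] /hk /(_ h). Qed.

Lemma hyperbolicJE a k h : hyperbolic a (k ^ h) -> hyperbolic a k.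
Proof. by move=> /(@hyperbolicJ _ _ _ h^-1); rewrite -conjgM mulgV conjg1. Qed.

(** Take [S] of least size such that a conjugate of [g] lies in the subgroup on [S]. If a further
    conjugate avoided some [a] in [S], retracting the conjugator to [S] would give a smaller set. *)
Lemma exists_full A g : Std A g -> exists S h,
  [/\ forall v, v \in S -> A v, Std A h & full [in S] (g ^ h)].
Proof.
move=> Ag.
pose P n := `[< exists S h, [/\ forall v, v \in S -> A v, Std A h,
  Std [in S] (g ^ h) & #|` S| = n] >].
have exP : exists n, P n.
  have [p pA gp] := Std_word Ag; pose S : {fset Gam} := [fset a.1 | a in p]%fset.
  exists #|` S|; apply/asboolP; exists S, 1; split=> //.
  - by move=> v /imfsetP[/= a ap ->]; exact: (allP pA).
  - exact: Std1.
  rewrite conjg1 gp; apply: Std_clP; apply/allP => a ap /=.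
  by apply/imfsetP; exists a.
case: (ex_minnP exP) => n /asboolP[S [h [SA Ah Sgh <-]]] minS.
exists S, h; split=> //; split=> // a Sa h' Hh'.
have : P #|` (S `\ a)%fset|.
  apply/asboolP; exists (S `\ a)%fset, (h * proj [in S] h'); split=> //.
  - by move=> v; rewrite !inE => /andP[_ /SA].
  - by apply: StdM => //; apply: Std_sub (Std_proj _ _) => v /SA.
  rewrite conjgM -[g ^ h]Sgh -projJ.
  apply: Std_sub (Std_projS [in S] Hh') => v /=; rewrite !inE.
  by [].
by move/minS; rewrite (cardfsD1 a S) Sa add1n ltnn.
Qed.

(** For [v] outside the closed star, use the tree of [v]: if [h] involved [v], some conjugate of [k]
    would lie in the subgroup on the link of [v]. Some [a] in [A] is not in that link, against
    hyperbolicity of [k] at [a]. *)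
Lemma full_centralizer A k h : full A k -> Std A (k ^ h) -> Std (closed_star A) h.
Proof.
move=> fk Akh; apply: Std_finite => v; rewrite negb_or => /andP[vA vl].
have AH g : Std A g -> Std (predC1 v) g.
  by apply: Std_sub => w Aw; apply: contraNneq vA => <-.
apply: contrapT => Hh; have [u Lu] := tree_fix (AH _ fk.1) (AH _ Akh) Hh.
move/linkP: vl; apply => a Aa; apply: contrapT => /negP av.
apply: (@full_conj_Std A k u a) => //; apply: Std_sub Lu => w vw.
by apply: contraNneq av => <-; rewrite adj_sym.
Qed.

Lemma full_commute A k z : full A k -> commute z k -> Std (closed_star A) z.
Proof.
move=> fk zk; apply: (full_centralizer fk).
by have /commuteP -> := commute_sym zk; exact: fk.1.
Qed.

Lemma closed_star_split A g : Std (closed_star A) g ->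
  g = proj A g * proj (link A) g.
Proof. by apply: proj_split => v w Av /linkP; exact. Qed.

Lemma link_commute A x z : Std A x -> Std (link A) z -> commute x z.
Proof. by apply: Std_commute => v w Av /linkP; exact. Qed.

Lemma StdJ_closed_star A x h : Std (closed_star A) h -> Std A x -> Std A (x ^ h).
Proof.
move=> /closed_star_split -> Ax; rewrite conjgM.
have Axp : Std A (x ^ proj A h) by apply: StdJ => //; exact: Std_proj.
suff /commuteP -> : commute (x ^ proj A h) (proj (link A) h) by [].
exact: (link_commute Axp (Std_proj _ _)).
Qed.

Lemma full_gen a : full (pred1 a) (x_ a).
Proof.
split=> [|b /eqP -> {b} h]; first by apply: Std_gen => /=.
move/(expo_Std (t := a)); rewrite expoJ expo_gen /= eqxx => /(_ isT).
by [].
Qed.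

Lemma commute_gen_star a z : commute z (x_ a) ->
  Std [pred v | (v == a) || adj a v] z.
Proof.
move/(full_commute (full_gen a)); apply: Std_sub => v /orP[/eqP ->|].
  by rewrite inE eqxx.
by move/linkP/(_ a); rewrite inE /= eqxx => /(_ isT) ->; rewrite orbT.
Qed.

Lemma gen_commuteE a v : a != v -> commute (x_ v) (x_ a) -> adj a v.
Proof.
move=> av /commute_gen_star Sv; apply: contrapT => /negP nav.
have nv : ~~ [pred v | (v == a) || adj a v] v.
  by rewrite /= (negbTE nav) orbF eq_sym.
by have := expo_Std nv Sv; rewrite expo_gen eqxx.
Qed.

(** Connectedness of the complement graph, phrased by closed subsets instead of paths. *)
Definition anticonnected A := (exists a, A a) /\
  forall B, (exists2 b, A b & B b) ->
    (forall b c, A b -> B b -> A c -> ~~ adj b c -> B c) -> forall a, A a -> B a.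

(** Let [S] be the essential support of [e]; a conjugate of [k] lies in the closed star of [S]. Were
    [S] smaller than [A], anticonnectedness would give [c] in [A] outside [S] and not adjacent to
    some vertex of [S], hence outside this closed star, against fullness of [k]. *)
Lemma full_of_commute A k e : anticonnected A -> full A k -> Std A e ->
  commute e k -> e <> 1 -> full A e.
Proof.
move=> [_ cA] fk Ae ek e1; have [S [u [SA Au fe]]] := exists_full Ae.
have Sk : Std (closed_star [in S]) (k ^ u).
  by apply: (full_commute fe); apply/commuteJ/commute_sym.
have AS : forall a, A a -> a \in S.
  apply: cA => [|b c Ab Sb Ac nbc].
    case: (fset_0Vmem S) => [S0|[b bS]]; last by exists b; rewrite ?SA.
    case: e1; apply/eqP; rewrite -(conjg_eq1 _ u); apply/eqP.
    by apply: Std_pred0 fe.1 => v /=; rewrite S0.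
  apply: contrapT => /negP Sc; apply: (full_conj_Std fk Ac (h := u)).
  apply: Std_sub Sk => v; apply: contraTneq => ->; rewrite negb_or Sc /=.
  by apply/linkP => /(_ b Sb); rewrite (negbTE nbc).
by split=> // a /AS /(fe.2) /hyperbolicJE.
Qed.

(** The tree of one [a] in [A] yields a product of powers of [h] and [k] with a conjugate avoiding
    [a]. It commutes with [k], so by [full_of_commute] it is trivial. *)
Lemma full_commute_power A k h : anticonnected A -> full A k -> Std A h ->
    commute h k ->
  exists n m, (0 < n)%N /\ (h ^+ n = k ^+ m \/ h ^+ n = k ^- m).
Proof.
move=> cA fk Ah hk; have [[a Aa] _] := cA.
have [n [m [g [n0 Hg]]]] := hyperbolic_commute (fk.2 a Aa) hk.
have key e : Std A e -> commute e k -> Std (predC1 a) (e ^ g) -> e = 1.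
  move=> Ae ek He; apply: contrapT => e1.
  exact: full_conj_Std (full_of_commute cA fk Ae ek e1) Aa He.
have hnk : commute (h ^+ n) k by apply/commute_sym/commuteX/commute_sym.
exists n, m; split=> //; case: Hg => Hg; [right|left].
  have /key /(_ _ Hg)/eqP : Std A (h ^+ n * k ^+ m).
    by apply: StdM; apply: StdX => //; exact: fk.1.
  rewrite mulg_eq1 => h1; apply/eqP/h1.
  by apply: commuteMl => //; apply/commute_sym/commuteX/commute_refl.
have /key /(_ _ Hg)/divg1_eq : Std A (h ^+ n * k ^- m).
  by apply: StdM; [|apply: StdV]; apply: StdX => //; exact: fk.1.
apply; apply: commuteMl => //; apply/commuteVl/commute_sym/commuteX.
exact: commute_refl.
Qed.

Lemma full_expg A k n : anticonnected A -> full A k -> (0 < n)%N -> k ^+ n <> 1.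
Proof. by move=> [[a Aa] _] [_ /(_ a Aa)]; exact: hyperbolic_expg. Qed.

(** The [A] component of [l ^ h] decides. If it is trivial, [B] lies in the link of [A], and [h] may
    be replaced by its projection there. If not, this component is full in [A], which forces
    [A = B], and [full_centralizer] locates [h]. *)
Lemma full_commute_dichotomy A B k l h :
    anticonnected A -> anticonnected B -> full A k -> full B l ->
    commute k (l ^ h) ->
  (forall x y, Std A x -> Std B y -> commute x (y ^ h)) \/
  (A =1 B /\ Std (closed_star A) h).
Proof.
move=> cA cB fk fl kq.
have Sq : Std (closed_star A) (l ^ h).
  by apply: (full_commute fk); apply: commute_sym.
have Bstar b : B b -> closed_star A b.
  move=> Bb; apply: contrapT => nb; apply: (full_conj_Std fl Bb (h := h)).
  by apply: Std_sub Sq => v sv; apply/negP => /eqP vb; apply: nb; rewrite -vb.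
have [q1|q1] := pselect (proj A (l ^ h) = 1).
  left; have lq : Std (link A) (l ^ h).
    by rewrite (closed_star_split Sq) q1 mul1g; exact: Std_proj.
  have BlA b : B b -> link A b.
    move=> Bb; apply: contrapT => nb; apply: (full_conj_Std fl Bb (h := h)).
    by apply: Std_sub lq => v sv; apply/negP => /eqP vb; apply: nb; rewrite -vb.
  have Sl : Std (link A) l by apply: Std_sub fl.1.
  have hp : Std (closed_star B) (h * (proj (link A) h)^-1).
    apply: (full_centralizer fl); rewrite conjgM.
    have -> : l ^ h = l ^ proj (link A) h by rewrite -{1}lq projJ Sl.
    by rewrite -conjgM mulgV conjg1; exact: fl.1.
  move=> x y Ax By; apply: (link_commute Ax).
  have -> : y ^ h = (y ^ (h * (proj (link A) h)^-1)) ^ proj (link A) h.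
    by rewrite -!conjgM mulgVK.
  apply: StdJ; last exact: Std_proj.
  by apply: (Std_sub BlA); exact: StdJ_closed_star.
right; have fq : full A (proj A (l ^ h)).
  apply: (full_of_commute cA fk) => //; first exact: Std_proj.
  rewrite -[k]fk.1; apply: gmulf_commute; exact: commute_sym.
have AB a : A a -> B a.
  move=> Aa; apply: contrapT => nBa.
  apply: (full_conj_Std fq Aa (h := (proj A h)^-1)).
  rewrite projJ -conjgM mulgV conjg1.
  apply: Std_sub (Std_projS A fl.1) => v /= /andP[Bv _].
  by apply/negP => /eqP va; apply: nBa; rewrite -va.
have BA b : B b -> A b.
  have [[a Aa] _] := cA; apply: cB.2 => [|b' c Bb' Ab' Bc nbc].
    by exists a; rewrite ?AB.
  have /orP[//|/linkP/(_ b' Ab')] := Bstar c Bc.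
  by rewrite (negbTE nbc).
have eAB : A =1 B by move=> v; apply/idP/idP => [/AB|/BA].
split=> //; have fl' : full A l.
  split; first by apply: Std_sub fl.1.
  by move=> a /AB; exact: fl.2.
apply: (full_centralizer fl').
suff q2 : proj (link A) (l ^ h) = 1.
  by rewrite (closed_star_split Sq) q2 mulg1; exact: Std_proj.
rewrite projJ [proj _ l](_ : _ = 1) ?conj1g//.
apply: Std_pred0 (Std_projS _ fl'.1) => v /=.
by case: (boolP (A v)) => //= /link_disjoint/negbTE.
Qed.

(** * Connected components of the complement graph *)

Section Components.
Variables (S : {fset Gam}).

(** The intersection of all sets that contain [s] and are closed under steps to nonadjacent vertices
    of [S]. *)
Definition component s : pred Gam := [pred v | `[< forall B, B s ->
  (forall b c, B b -> c \in S -> ~~ adj b c -> B c) -> B v >]].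

Lemma component_refl s : component s s.
Proof. by apply/asboolP. Qed.

Lemma component_step s b c :
  component s b -> c \in S -> ~~ adj b c -> component s c.
Proof.
move=> /asboolP sb cS nbc; apply/asboolP => B Bs BB.
exact: (BB b) (sb B Bs BB) cS nbc.
Qed.

Lemma component_sub s v : s \in S -> component s v -> v \in S.
Proof. by move=> sS /asboolP/(_ [in S] sS); exact. Qed.

Lemma component_compl s b c :
  component s b -> c \in S -> ~~ component s c -> adj b c.
Proof. by move=> sb cS; apply: contraNT; exact: component_step. Qed.

Lemma component_anticonnected s : s \in S -> anticonnected (component s).
Proof.
move=> sS; split; first by exists s; exact: component_refl.
move=> B [b sb Bb] BB; suff Bs : B s.
  move=> a /asboolP/(_ (predI (component s) B)) sa.
  apply: (proj2 (andP (sa _ _))); first by rewrite /= component_refl.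
  move=> b' c /andP[sb' Bb'] cS nbc; rewrite /= (component_step sb')//=.
  exact: (BB b') (component_step sb' cS nbc) nbc.
apply: contrapT => /negP nBs.
have /asboolP/(_ (predI (component s) (predC B))) := sb.
move=> sa; apply: (negP (proj2 (andP (sa _ _))) Bb).
  by rewrite /= component_refl.
move=> b' c /andP[sb' nBb'] cS nbc; have sc := component_step sb' cS nbc.
rewrite /= sc /=; apply: contra nBb' => Bc; apply: (BB c) => //.
by rewrite adj_sym.
Qed.

(** The rest of [k] commutes with the subgroup on [C] and does not involve [a], so a conjugate of
    the [C] part avoiding [a] would give such a conjugate of [k]. *)
Lemma component_full s k : full [in S] k -> s \in S ->
  full (component s) (proj (component s) k).
Proof.
move=> fk sS; set C := component s.
have ek : k = proj C k * proj (predI [in S] (predC C)) k.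
  apply: proj_split => [v w sv /andP[wS nsw]|]; first exact: component_compl sv wS nsw.
  apply: Std_sub fk.1 => v vS; rewrite inE/= [v \in S]vS /=.
  by rewrite orbN.
split=> [|a Ca h Hh]; first exact: Std_proj.
have aS := component_sub sS Ca.
apply: (full_conj_Std fk aS (h := proj C h)); rewrite ek conjMg.
have Hp : Std (predC1 a) (proj C k ^ proj C h).
  rewrite -[proj C k](Std_proj C k) -projJ.
  by apply: Std_sub (Std_projS C Hh) => v /andP[].
apply: StdM => //.
suff /commuteP -> : commute (proj (predI [in S] (predC C)) k) (proj C h).
  apply: Std_sub (Std_proj _ _) => v /andP[_]; apply: contraNneq => ->.
  exact: Ca.
apply: (Std_commute _ (Std_proj _ _) (Std_proj _ _)) => v w /andP[vS nsv] sw.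
by rewrite adj_sym; exact: component_compl sw vS nsv.
Qed.

(** [z] lies in the closed star of [S], hence is a [C] part times a factor commuting with everything
    on [C]. Retraction to [C] preserves commutation with [k]. *)
Lemma component_commute s k z : full [in S] k -> s \in S -> commute z k ->
  commute z (proj (component s) k).
Proof.
move=> fk sS zk; set C := component s.
have CD v w : C v -> (predU (predI [in S] (predC C)) (link [in S])) w -> adj v w.
  move=> Cv /orP[/andP[wS nCw]|/linkP]; first exact: component_compl Cv wS nCw.
  by apply; exact: component_sub Cv.
rewrite (@proj_split _ C (predU (predI [in S] (predC C)) (link [in S])) z)//.
  apply: commuteMl; first exact: gmulf_commute.
  apply: commute_sym; apply: (Std_commute CD); exact: Std_proj.
apply: Std_sub (full_commute fk zk) => v /= /orP[vS|vl]; last by rewrite vl !orbT.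
by rewrite vS; case: (C v).
Qed.

Lemma component_commute_power k z N : Std [in S] k ->
    (forall s, s \in S -> commute z (proj (component s) k ^+ N)) ->
  commute z (k ^+ N).
Proof.
move=> Sk zk; rewrite -Sk.
(* Generalized to sets closed under nonadjacency, that is unions of components, so that one
   component can be split off at a time. *)
suff key (B : {fset Gam}) : (forall b, b \in B -> b \in S) ->
    (forall b c, b \in B -> c \in S -> ~~ adj b c -> c \in B) ->
    commute z (proj [in B] k ^+ N) by apply: key.
have [n] := ubnP #|` B|; elim: n B => // n IH B Bn BS BB.
case: (fset_0Vmem B) => [B0|[s sB]].
  rewrite (_ : proj _ k = 1) ?expg1n; first exact: commute1.
  by apply: Std_pred0 (Std_proj _ _) => v /=; rewrite B0.
set C := component s; pose B' := [fset v in B | ~~ C v]%fset.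
have CB v : C v -> v \in B by move=> /asboolP/(_ [in B] sB); exact.
have B'E v : (v \in B') = (v \in B) && ~~ C v by rewrite !inE.
have CB' v w : C v -> w \in B' -> adj v w.
  by move=> Cv; rewrite B'E => /andP[/BS wS nCw]; exact: component_compl Cv wS nCw.
have e : proj [in B] k = proj C k * proj [in B'] k.
  rewrite {1}(@proj_split _ C [in B'] (proj [in B] k))//; last first.
    apply: Std_sub (Std_proj _ _) => v vB; rewrite /= B'E [v \in B]vB /=.
    by rewrite orbN.
  rewrite !proj_proj; congr (_ * _); apply: eq_proj => v /=.
    by case: (boolP (C v)) => //= /CB.
  by rewrite B'E; case: (v \in B); rewrite ?andbF ?andbT.
have cCB' : commute (proj C k) (proj [in B'] k).
  by apply: (Std_commute CB'); exact: Std_proj.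
rewrite e expgMn//; apply: commuteM; first by apply: zk; exact: BS.
apply: IH => [|b|b c].
- move: Bn; rewrite (cardfsD1 s B) sB add1n ltnS; apply: leq_trans.
  apply/fsubset_leq_card/fsubsetP => v; rewrite B'E !inE => /andP[-> nCv].
  by rewrite andbT; apply: contraNneq nCv => ->; exact: component_refl.
- by rewrite B'E => /andP[/BS].
rewrite !B'E => /andP[bB nCb] cS nbc; rewrite (BB b)//=.
apply: contra nCb => Cc; apply: (component_step Cc) (BS _ bB) _.
by rewrite adj_sym.
Qed.

End Components.

End Supports.

(** * Choosing vertices of the extension graph *)

Section Filling.
Variable Gam : graph.
Implicit Types (a v w : Gam) (A B C : pred Gam) (S : {fset Gam}).
Local Notation G := (raag Gam).
Implicit Types g h k u x y z : G.
Local Notation x_ := (@raag_gen Gam).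
Local Notation pos := (@pos Gam).

Definition nadj : rel Gam := [rel v w | (v != w) && ~~ adj v w].

(** The palindrome that runs along [l] and back; the outermost letters can be stripped in pairs. *)
Fixpoint filling (l : seq Gam) : seq Gam :=
  if l is c :: l' then c :: filling l' ++ [:: c] else [::].

(** [tree_pos] at the two outer letters [c] puts both [z] and its conjugate by the inner word into
    the subgroup on the link of [c]. The next vertex [c'] is not in that link, so the argument
    repeats in the tree of [c']. *)
Lemma filling_fix c l z t : path nadj c l ->
    Std (predC1 c) z -> Std (predC1 c) (z ^ pos (filling (c :: l) ++ t)) ->
  forall d, d \in c :: l -> Std (adj d) z.
Proof.
elim: l c t => [|c' l IH] c t pcl Hz Hzu.
  move=> d; rewrite inE => /eqP ->.
  by have := tree_pos (s := [::]) Hz Hzu; rewrite conjg1.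
have Lz : Std (adj c) z.
  by have := tree_pos (s := [::]) Hz Hzu; rewrite conjg1.
have Lzu : Std (adj c) (z ^ pos (filling (c' :: l))).
  move: Hzu; rewrite -[filling _]/((c :: filling (c' :: l)) ++ [:: c]) -catA.
  move/(tree_pos Hz); rewrite -cat1s pos_cat conjgM pos1.
  suff /commuteP -> : commute z (x_ c) by [].
  apply/commute_sym; apply: Std_commute_gen Lz => v; exact: commute_gen.
move: pcl => /= /andP[/andP[cc' ncc'] pl] d; rewrite inE => /orP[/eqP -> //|].
have sub : forall v, adj c v -> predC1 c' v.
  by move=> v cv; apply: contraNneq ncc' => <-.
apply: (IH c' [::] pl (Std_sub sub Lz)).
by rewrite cats0; exact: Std_sub sub Lzu.
Qed.

Lemma anticonnected_path A a b : anticonnected A -> A a -> A b ->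
  exists l, [/\ path nadj a l, all A l & last a l = b].
Proof.
move=> [_ cA] Aa Ab.
pose B := [pred v | `[< exists l, [/\ path nadj a l, all A l & last a l = v] >]].
suff /(_ b Ab)/asboolP : forall v, A v -> B v by [].
apply: cA => [|v w Av /asboolP[l [pl Al lv]] Aw nvw].
  by exists a => //; apply/asboolP; exists [::].
apply/asboolP; have [vw|vw] := eqVneq v w; first by exists l; rewrite -vw.
exists (rcons l w); rewrite rcons_path all_rcons last_rcons pl Aw Al lv.
by rewrite /nadj /= vw nvw.
Qed.

Lemma anticonnected_walk A a (t : seq Gam) : anticonnected A -> A a -> all A t ->
  exists l, [/\ path nadj a l, all A l & forall v, v \in t -> v \in a :: l].
Proof.
move=> cA Aa; elim: t => [|v t IH] /=; first by exists [::].
move=> /andP[Av /IH[l [pl Al tl]]].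
have All : A (last a l).
  by have := mem_last a l; rewrite inE => /orP[/eqP ->//|]; exact: (allP Al).
have [l' [pl' Al' lv]] := anticonnected_path cA All Av.
exists (l ++ l'); rewrite cat_path all_cat pl Al pl' Al'; split=> // w.
rewrite inE => /orP[/eqP ->|/tl]; last first.
  by rewrite !inE mem_cat => /orP[->//|->]; rewrite orbT.
by rewrite -lv -last_cat mem_last.
Qed.

Lemma pos_expg s n : pos s ^+ n = pos (flatten (nseq n s)).
Proof. by elim: n => [|n IH]; rewrite ?expgS ?IH -?pos_cat. Qed.

Lemma pos_Std A s : all A s -> Std A (pos s).
Proof. by move=> As; apply: Std_clP; rewrite all_map. Qed.

Lemma all_filling A l : all A l -> all A (filling l).
Proof.
by elim: l => //= c l IH /andP[Ac /IH Al]; rewrite Ac all_cat Al /= Ac.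
Qed.

(** The filling omits [a]: commuting with [a] already keeps [z] and its conjugate off the first
    vertex of [l], which is not adjacent to [a]. Only the first copy of the filling is used. *)
Lemma filling_commute a l z n : path nadj a l -> (0 < n)%N ->
    commute z (x_ a) -> commute (z ^ (pos (filling l) ^+ n)) (x_ a) ->
  forall v, v \in a :: l -> commute z (x_ v).
Proof.
move=> pl n0 za zua v; rewrite inE => /orP[/eqP -> //|vl].
suff Lz : Std (adj v) z.
  by apply/commute_sym; apply: Std_commute_gen Lz => w; exact: commute_gen.
case: l pl vl zua => // c l /= /andP[ac pl] vl zua.
have sub : forall w, (w == a) || adj a w -> predC1 c w.
  move=> w /= wa; move: ac => /andP[ac nac]; apply: contraNneq nac => wc.
  by move: wa; rewrite wc eq_sym (negbTE ac).
apply: (filling_fix (t := flatten (nseq n.-1 (filling (c :: l)))) pl) => //.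
  exact: Std_sub sub (commute_gen_star za).
have -> : pos (filling (c :: l) ++ flatten (nseq n.-1 (filling (c :: l)))) =
    pos (filling (c :: l)) ^+ n.
  by rewrite pos_expg -[in RHS](prednK n0).
exact: Std_sub sub (commute_gen_star zua).
Qed.

(* The conjugates [a ^ (u ^+ n)] are far apart in the extension graph: two of
   them already have the same centralizer as the whole parabolic subgroup. *)
Lemma exists_filling S : anticonnected [in S] -> exists a u,
  [/\ a \in S, Std [in S] u &
    forall y n m, n != m -> commute y (x_ a ^ (u ^+ n)) ->
      commute y (x_ a ^ (u ^+ m)) -> forall g, Std [in S] g -> commute y g].
Proof.
move=> cS; have [[a aS] _] := cS.
have [|l [pl Sl cl]] := anticonnected_walk (t := enum_fset S) cS aS.
  by apply/allP => v; rewrite -[_ \in enum_fset _]/(v \in S).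
exists a, (pos (filling l)); set u := pos _.
have Su : Std [in S] u by apply: pos_Std; exact: all_filling.
split=> // y n m; wlog nm : n m / (n < m)%N.
  move=> wl; rewrite neq_ltn => /orP[nm|mn] yn ym.
    by apply: (wl n m) => //; rewrite ltn_eqF.
  by apply: (wl m n) => //; rewrite ltn_eqF.
(* After this conjugation both [z] and its conjugate by [u ^+ (m - n)] commute with [x_ a]. Once [z]
   centralizes the whole subgroup on [S], it commutes with [u], so [y = z]. *)
move=> _ yn ym; pose z := y ^ (u ^- m).
have za : commute z (x_ a).
  by apply/(@commuteJ _ _ _ (u ^+ m)); rewrite -conjgM mulVg conjg1.
have zua : commute (z ^ (u ^+ (m - n))) (x_ a).
  apply/(@commuteJ _ _ _ (u ^+ n)); rewrite -conjgM -expgnDr subnK ?(ltnW nm)//.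
  by rewrite /z -conjgM mulVg conjg1.
have zS : forall g, Std [in S] g -> commute z g.
  move=> g; apply: Std_commute_gen => v vS.
  by apply: (filling_commute pl _ za zua) (cl v vS); rewrite subn_gt0.
suff -> : y = z by [].
have /commuteP <- : commute z (u ^+ m) by apply/zS/StdX.
by rewrite /z -conjgM mulVg conjg1.
Qed.

End Filling.

(** * Irreducible factors, commensurability and the choice of vertices *)

Section PureFactors.
Variable Gam : graph.
Local Notation G := (raag Gam).
Local Notation x_ := (@raag_gen Gam).
Implicit Types (g h k x y z : G) (S : {fset Gam}).

(* [(S, h, k)] encodes the irreducible element [k ^ h] of the parabolic subgroup
   [<S> ^ h]. *)
Local Notation factor := ({fset Gam} * G * G)%type.
Implicit Types c d : factor.

Definition supp c := [in c.1.1].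
Definition elt c : G := c.2 ^ c.1.2.
Definition par c g := Std (supp c) (g ^ c.1.2^-1).
Definition pure c := anticonnected (supp c) /\ full (supp c) c.2.
Definition par_commute c d := forall x y, par c x -> par d y -> commute x y.
(** The subgroup on the closed star normalizes the one on the support, so this makes the two
    parabolic subgroups equal. *)
Definition same_par c d :=
  c.1.1 = d.1.1 /\ Std (closed_star (supp c)) (d.1.2 * c.1.2^-1).
Definition commens c d := same_par c d /\ exists n m,
  [/\ (0 < n)%N, (0 < m)%N & elt c ^+ n = elt d ^+ m \/ elt c ^+ n = elt d ^- m].
(** The two ways in which pure factors commute, in a form invariant under commensurability. *)
Definition dep c d := par_commute c d \/ commens c d.

Lemma par_elt c : pure c -> par c (elt c).
Proof. by move=> [_ [Sk _]]; rewrite /par /elt -conjgM mulgV conjg1. Qed.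

Lemma same_par_refl c : same_par c c.
Proof. by split=> //; rewrite mulgV; exact: Std1. Qed.

Lemma same_par_sym c d : same_par c d -> same_par d c.
Proof.
move=> [e /StdV]; rewrite invgM invgK => h; split; first exact: esym.
by rewrite /supp -e.
Qed.

Lemma same_par_trans d c c' : same_par c d -> same_par d c' -> same_par c c'.
Proof.
move=> [e h] [e' h']; split; first by rewrite e.
rewrite /supp -e in h'.
by have := StdM h' h; rewrite mulgA mulgVK.
Qed.

Lemma same_par_sub c d g : same_par c d -> par d g -> par c g.
Proof.
rewrite /par => -[e h]; rewrite /supp -e => dg.
by have := StdJ_closed_star h dg; rewrite -conjgM mulKg.
Qed.

Lemma commens_refl c : commens c c.
Proof. by split; [exact: same_par_refl|exists 1%N, 1%N; split=> //; left]. Qed.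

Lemma commens_sym c d : commens c d -> commens d c.
Proof.
move=> [/same_par_sym cd [n [m [n0 m0 e]]]]; split=> //; exists m, n; split=> //.
by case: e => ->; [left|right; rewrite invgK].
Qed.

Lemma commens_trans d c c' : commens c d -> commens d c' -> commens c c'.
Proof.
move=> [cd [n [m [n0 m0 e]]]] [dc' [n' [m' [n0' m0' e']]]].
split; first exact: same_par_trans dc'.
exists (n * n')%N, (m' * m)%N; split; rewrite ?muln_gt0 ?n0 ?n0' ?m0 ?m0'//.
have eX (x y : G) : x = y \/ x = y^-1 -> forall q, x ^+ q = y ^+ q \/ x ^+ q = y ^- q.
  by move=> [->|->] q; [left|right; rewrite expVgn].
rewrite !expgnA; have {e} := eX _ _ e n'; have {e'} := eX _ _ e' m.
rewrite (expgnAC _ n' m).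
by case=> ->; case=> ->; rewrite ?invgK; [left|right|right|left].
Qed.

Lemma par_commute_sym c d : par_commute c d -> par_commute d c.
Proof. by move=> cd x y dx cy; apply/commute_sym/cd. Qed.

Lemma par_commute_commens c c' d : commens c c' -> par_commute c d -> par_commute c' d.
Proof.
by move=> [/same_par_sub cc' _] cd x y /cc'; exact: cd.
Qed.

Lemma dep_sym c d : dep c d -> dep d c.
Proof. by move=> [/par_commute_sym|/commens_sym]; [left|right]. Qed.

Lemma dep_commens c c' d : commens c c' -> dep c d -> dep c' d.
Proof.
move=> cc' [/(par_commute_commens cc')|cd]; [by left|right].
exact: commens_trans (commens_sym cc') cd.
Qed.

Lemma same_par_commens c d : pure c -> pure d -> same_par c d ->
  commute (elt c) (elt d) -> commens c d.
Proof.
move=> [cc fc] [_ fd] cd cde; split=> //; have [e h] := cd.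
rewrite /supp -e -/(supp c) in fd.
have fd' : full (supp c) (d.2 ^ (d.1.2 * c.1.2^-1)).
  split; first exact: StdJ_closed_star h fd.1.
  by move=> a ca; apply: hyperbolicJ; exact: fd.2.
have comm : commute c.2 (d.2 ^ (d.1.2 * c.1.2^-1)).
  by apply/(@commuteJ _ _ _ c.1.2); rewrite -conjgM mulgVK.
have [n [m [n0 nm]]] := full_commute_power cc fd' fc.1 comm.
exists n, m; split=> //.
  rewrite lt0n; apply/negP => /eqP m0; apply: (full_expg cc fc n0).
  by case: nm; rewrite m0 expg0 ?invg1.
have -> : elt d = (d.2 ^ (d.1.2 * c.1.2^-1)) ^ c.1.2 by rewrite -conjgM mulgVK.
rewrite /elt -(conjXg c.2) -(conjXg (_ ^ _)) -conjVg.
by case: nm => ->; [left|right].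
Qed.

Lemma commute_dep c d : pure c -> pure d -> commute (elt c) (elt d) -> dep c d.
Proof.
move=> pc pd cde.
have comm : commute c.2 (d.2 ^ (d.1.2 * c.1.2^-1)).
  by apply/(@commuteJ _ _ _ c.1.2); rewrite -conjgM mulgVK.
have [cd|[e h]] := full_commute_dichotomy pc.1 pd.1 pc.2 pd.2 comm.
  left=> x y cx dy; apply/(@commuteJ _ _ _ c.1.2^-1).
  by have := cd _ _ cx dy; rewrite -conjgM mulKg.
right; apply: same_par_commens => //; split=> //.
by apply/fsetP => v; exact: e.
Qed.

(** The second and third clauses compare the centralizer of [g] with those of its factors; powers
    appear because commensurability relates factors only through their powers. The fourth clause
    lets elimination detect a factor by projection. *)
Definition factors_spec g (F : seq factor) :=
  [/\ forall c, c \in F -> pure c,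
      forall c z, c \in F -> commute z g -> commute z (elt c),
      forall z N, (forall c, c \in F -> commute z (elt c ^+ N)) -> commute z (g ^+ N),
      forall c, c \in F -> proj (supp c) (g ^ c.1.2^-1) = c.2
    & g <> 1 -> F <> [::]].

Lemma exists_factors g : exists F, factors_spec g F.
Proof.
have [S [h [_ _ fk]]] := exists_full (StdT g).
set k := g ^ h in fk.
pose C s : {fset Gam} := [fset v in S | component S s v]%fset.
pose F := [seq (C s, h^-1, proj (component S s) k) | s <- enum_fset S].
have CE s : s \in S -> [in C s] = component S s.
  move=> sS; apply/funext => v; rewrite /C !inE.
  by case: (boolP (component S s v)) => [/(component_sub sS) ->|]; rewrite ?andbF.
have FP (P : factor -> Prop) :
    (forall s, s \in S -> P (C s, h^-1, proj (component S s) k)) ->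
    forall c, c \in F -> P c.
  by move=> PS c /mapP[s sS ->]; exact: PS.
have gk : g = k ^ h^-1 by rewrite /k conjgK.
exists F; split.
- apply: FP => s sS; rewrite /pure /supp /= CE//; split.
    exact: component_anticonnected.
  exact: component_full.
- move=> c z cF; move: c cF; apply: FP => s sS zg.
  apply/(@commuteJ _ _ _ h); rewrite /elt /= -conjgM mulVg conjg1.
  by apply: component_commute => //; apply/commuteJ.
- move=> z N zF; apply/(@commuteJ _ _ _ h); rewrite conjXg -/k.
  apply: (component_commute_power fk.1) => s sS.
  apply/(@commuteJ _ _ _ h^-1); rewrite conjgK conjXg.
  by have := zF (C s, h^-1, proj (component S s) k); apply; apply/mapP; exists s.
- by apply: FP => s sS; rewrite /supp /= CE// invgK.
move=> g1 /(congr1 size)/eqP; rewrite size_map; have [S0|[s sS]] := fset_0Vmem S.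
  case: g1; rewrite gk (_ : k = 1) ?conj1g//.
  by apply: Std_pred0 fk.1 => v; rewrite S0.
by rewrite size_eq0 => /eqP S0; move: sS; rewrite -[s \in S]/(s \in enum_fset S) S0.
Qed.

(** By [exists_filling], each [y] commutes with at most one of the candidates [X n], so every large
    [n] avoids the whole finite list. *)
Lemma exists_avoiding c (Y : seq G) : pure c ->
    (forall y, y \in Y -> exists2 g, par c g & ~ commute y g) ->
  exists x, [/\ extension_vertices x, par c x & forall y, y \in Y -> ~ commute y x].
Proof.
move=> pc YP; have [a [u [aS Su sep]]] := exists_filling pc.1.
pose X n := x_ a ^ (u ^+ n * c.1.2).
have [n nP] : exists N, forall n y, (N <= n)%N -> y \in Y -> ~ commute y (X n).
  elim: Y YP => [|y Y IH] YP; first by exists 0%N.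
  have [y' y'Y|N NP] := IH; first by apply: YP; rewrite inE y'Y orbT.
  have [[n0 yn0]|yn] := pselect (exists n0, commute y (X n0)); last first.
    exists N => n y' Nn; rewrite inE => /orP[/eqP ->|/(NP n y' Nn)//].
    by move=> yXn; apply: yn; exists n.
  exists (maxn N n0.+1) => n y'; rewrite geq_max => /andP[Nn n0n].
  rewrite inE => /orP[/eqP -> yn|/(NP n y' Nn)//].
  have [g cg] := YP y (mem_head _ _); apply; apply/(@commuteJ _ _ _ c.1.2^-1).
  apply: (sep _ n0 n) cg; first by rewrite ltn_eqF.
    by apply/(@commuteJ _ _ _ c.1.2); rewrite -!conjgM mulVg conjg1.
  by apply/(@commuteJ _ _ _ c.1.2); rewrite -!conjgM mulVg conjg1.
exists (X n); split; first by exists a, (u ^+ n * c.1.2).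
  rewrite /par /X -conjgM mulgK; apply: StdJ; first exact: Std_gen.
  exact: StdX.
by move=> y; exact: nP.
Qed.

(** The last clause keeps [x c] from centralizing too large a parabolic subgroup, which is what
    [exists_avoiding] asks of it when later vertices are chosen. *)
Definition vertex_spec (R : seq factor) (x : factor -> G) c :=
  [/\ extension_vertices (x c), par c (x c)
    & forall d, d \in R -> ~ par_commute c d ->
        exists2 y, par d y & ~ commute (x c) y].

(** Vertices are chosen one factor at a time. A factor commensurable with an earlier one reuses its
    vertex. The list [R] stays fixed while [R'] grows, so [vertex_spec] anticipates factors still to
    come. *)
Lemma exists_vertices (R : seq factor) : (forall c, c \in R -> pure c) ->
  exists x : factor -> G,
    [/\ forall c, c \in R -> vertex_spec R x c,
        forall c d, c \in R -> d \in R -> commens c d -> x c = x d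
      & forall c d, c \in R -> d \in R -> ~ dep c d -> ~ commute (x c) (x d)].
Proof.
move=> RP; suff key (R' : seq factor) : {subset R' <= R} ->
    exists x : factor -> G,
    [/\ forall c, c \in R' -> vertex_spec R x c,
        forall c d, c \in R' -> d \in R' -> commens c d -> x c = x d
      & forall c d, c \in R' -> d \in R' -> ~ dep c d -> ~ commute (x c) (x d)].
  exact: key.
elim: R' => [|c R' IH] sR; first by exists (fun=> 1).
have [d dR'|x [xP xE xD]] := IH; first by apply: sR; rewrite inE dR' orbT.
have [cR'|cR'] := boolP (c \in R').
  exists x; split=> [d|d d'|d d']; rewrite !inE.
  - by move=> /orP[/eqP ->|]; exact: xP.
  - by move=> /orP[/eqP ->|dR'] /orP[/eqP ->|dR'']; exact: xE.
  - by move=> /orP[/eqP ->|dR'] /orP[/eqP ->|dR'']; exact: xD.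
have cR : c \in R by apply: sR; rewrite mem_head.
have sR' d : d \in R' -> d \in R by move=> dR'; apply: sR; rewrite inE dR' orbT.
suff [g [gP gE gD]] : exists g,
    [/\ vertex_spec R (fun=> g) c,
        forall d, d \in R' -> commens c d -> g = x d
      & forall d, d \in R' -> ~ dep c d -> ~ commute g (x d)].
  pose x' d := if d == c then g else x d.
  have x'c : x' c = g by rewrite /x' eqxx.
  have x'R d : d \in R' -> x' d = x d.
    by rewrite /x' => dR'; case: eqP => // dc; rewrite -dc dR' in cR'.
  exists x'; split=> [d|d d'|d d']; rewrite !inE.
  - move=> /orP[/eqP ->|dR']; first by rewrite /vertex_spec x'c.
    by rewrite /vertex_spec x'R//; exact: xP.
  - move=> /orP[/eqP ->|dR'] /orP[/eqP ->|dR''] //; rewrite ?x'c ?x'R//.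
    + exact: gE.
    + by move=> /commens_sym; move/gE => ->.
    + exact: xE.
  - move=> /orP[/eqP ->|dR'] /orP[/eqP ->|dR'']; rewrite ?x'c ?x'R//.
    + by case; right; exact: commens_refl.
    + exact: gD.
    + by move=> dc /commute_sym; apply: gD => // /dep_sym.
    + exact: xD.
have [[d dR' cd]|nE] := pselect (exists2 d, d \in R' & commens c d).
  have [dv dp dn] := xP d dR'; exists (x d); split.
  - split=> //; first by apply: (same_par_sub cd.1).
    move=> d' d'R ncd'; apply: dn => // pdd'; apply: ncd'.
    exact: par_commute_commens (commens_sym cd) pdd'.
  - move=> d' d'R' cd'; apply: xE => //; exact: commens_trans (commens_sym cd) cd'.
  - move=> d' d'R' ncd'; apply: xD => // pdd'; apply: ncd'.
    exact: dep_commens (commens_sym cd) pdd'.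
have /choice[yf yP] : forall d, exists y, ~ par_commute c d ->
    par d y /\ exists2 g, par c g & ~ commute y g.
  move=> d; have [?|/existsNP[g /existsNP[y]]] := pselect (par_commute c d).
    by exists 1.
  move=> /not_implyP[cg /not_implyP[dy ngy]]; exists y => _; split=> //.
  by exists g => // /commute_sym.
(* To be avoided: the earlier vertices, for noncommutation with them, and the elements [yf d], which
   then witness [vertex_spec]. *)
pose Y := [seq x d | d <- R' & `[< exists2 g, par c g & ~ commute (x d) g >]] ++
  [seq yf d | d <- R & `[< ~ par_commute c d >]].
have [y|g [gv cg gY]] := @exists_avoiding c Y (RP c cR).
  rewrite mem_cat => /orP[] /mapP[d]; rewrite mem_filter => /andP[/asboolP dP _] ->//.
  by have [] := yP d dP.
exists g; split.
- split=> // d dR ncd; exists (yf d); first by have [] := yP d ncd.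
  move=> /commute_sym; apply: gY; rewrite mem_cat; apply/orP; right.
  by apply: map_f; rewrite mem_filter dR andbT; apply/asboolP.
- by move=> d dR' cd; case: nE; exists d.
move=> d dR' ncd /commute_sym; apply: gY; rewrite mem_cat; apply/orP; left.
apply: map_f; rewrite mem_filter dR' andbT; apply/asboolP.
have [_ _ dn] := xP d dR'; apply: dn => // pdc; apply: ncd; left.
exact: par_commute_sym.
Qed.

End PureFactors.

(** * Twin vertices and elimination *)

Section Noncommuting.
Variable Gam : graph.
Implicit Types (v w : Gam) (A B : pred Gam).
Local Notation G := (raag Gam).
Implicit Types g h : G.

Lemma raag_torsion_free g n : (0 < n)%N -> g ^+ n = 1 -> g = 1.
Proof.
move=> n0 gn; apply: contrapT => g1.
have [S [h [_ _ [Sg hg]]]] := exists_full (StdT g).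
have [S0|[s sS]] := fset_0Vmem S.
  apply/g1/eqP; rewrite -(conjg_eq1 _ h); apply/eqP.
  by apply: Std_pred0 Sg => v; rewrite S0.
apply: (hyperbolic_expg (hg s sS) n0).
by rewrite -conjXg gn conj1g.
Qed.

(** Take [v] in [A] occurring in [g ^+ n]. In the tree of [v], [h] would fix the base vertex and its
    image, so a conjugate of [h] would lie in the subgroup on the link of [v]. This link misses [B],
    so retracting to [B] makes [h] trivial. *)
Lemma Std_not_commute A B g h n : (0 < n)%N ->
    (forall v w, A v -> B w -> v != w /\ ~~ adj v w) ->
    Std A g -> Std B h -> g <> 1 -> h <> 1 ->
  ~ commute h (g ^+ n).
Proof.
move=> n0 AB Ag Bh g1 h1 /commuteP hgn.
have gn1 : g ^+ n <> 1 by move=> /(raag_torsion_free n0).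
have [v Av gv] : exists2 v, A v & ~ Std (predC1 v) (g ^+ n).
  apply: contrapT => nv; apply: gn1; apply: (@Std_pred0 _ pred0) => //.
  apply: Std_finite => v _; apply: contrapT => gv; apply: nv; exists v => //.
  apply: contrapT => nAv; apply: gv; apply: Std_sub (StdX n Ag) => w Aw.
  by apply/negP => /eqP wv; apply: nAv; rewrite -wv.
have Hh : Std (predC1 v) h.
  by apply: Std_sub Bh => w Bw; rewrite /= eq_sym; have [] := AB v w Av Bw.
have [|u Lu] := tree_fix Hh _ gv; first by rewrite hgn.
apply: h1; apply/eqP; rewrite -(conjg_eq1 _ (proj B u)); apply/eqP.
rewrite -[h in h ^ _]Bh -projJ.
apply: Std_pred0 (Std_projS B Lu) => w /=.
case: (boolP (B w)) => [Bw|]; rewrite ?andbF// andbT.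
by have [_ /negbTE] := AB v w Av Bw.
Qed.

End Noncommuting.

(** * Gaussian elimination of irreducible factors *)

Section Elimination.
Import GRing.Theory.
Variables (Lam Gam : graph) (f : {multiplicative raag Lam -> raag Gam}).
Hypothesis f_inj : injective f.
Local Notation factor := ({fset Gam} * raag Gam * raag Gam)%type.
Variable fac : raag Gam -> seq factor.
Hypothesis facP : forall g, factors_spec g (fac g).
Implicit Types (s : nat -> raag Lam) (T : pred Lam) (t : Lam).

Lemma gmul1 : f 1 = 1.
Proof. by apply: (@mulgI _ (f 1)); rewrite -gmulfM !mulg1. Qed.

Lemma gmul_expg g n : f (g ^+ n) = f g ^+ n.
Proof. by elim: n => [|n IH]; rewrite ?expg0 ?gmul1// !expgS gmulfM IH. Qed.

Definition subgroup (D : raag Lam -> Prop) :=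
  [/\ D 1, forall g h, D g -> D h -> D (g * h) & forall g, D g -> D g^-1].

Lemma subgroupX D g n : subgroup D -> D g -> D (g ^+ n).
Proof.
by move=> [D1 DM _] Dg; elim: n => // n; rewrite expgS; exact: DM.
Qed.

Definition separates g h := exists2 c, c \in fac (f g) &
  forall d, d \in fac (f h) -> ~ commens c d.

(** Linear independence over the integers of the exponent vectors of the [s i], with coordinates in
    [T]. *)
Definition independent T m s := forall c : nat -> int,
  (forall t, T t -> \sum_(i < m) c i * expo t (s i) = 0)%R ->
  forall i, (i < m)%N -> c i = 0%R.

Lemma kill_factor c g : c \in fac (f g) ->
  proj (supp c) (f g ^ c.1.2^-1) <> 1.
Proof.
move=> cg; have [Fp _ _ Fv _] := facP (f g); rewrite Fv//.
by have [cc fc] := Fp c cg; have := full_expg cc fc (n := 1); rewrite expg1; apply.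
Qed.

(** Inside the parabolic subgroup of [c], a positive power of the component of [f h] is a power of
    the component of [f g], so a product of powers of [h] and [g] cancels it. Positivity of [n]
    later preserves independence. *)
Lemma eliminate c g h : c \in fac (f g) -> commute h g ->
  exists r (n : nat) (e : int), [/\ (0 < n)%N,
    forall t, expo t r = (n%:R * expo t h + e * expo t g)%R,
    proj (supp c) (f r ^ c.1.2^-1) = 1
  & forall D, subgroup D -> D g -> D h -> D r].
Proof.
move=> cg hg; have [Fp Fc _ Fv _] := facP (f g).
have [cc fc] := Fp c cg; have ck := Fv c cg.
have hc : commute (f h) (elt c) by apply: Fc => //; exact: gmulf_commute.
pose p g := proj (supp c) (f g ^ c.1.2^-1).
have pM x y : p (x * y) = p x * p y by rewrite /p gmulfM conjMg projM.
have p1 : p 1 = 1 by rewrite /p gmul1 conj1g projg1.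
have pV x : p x^-1 = (p x)^-1 by apply: (@mulgI _ (p x)); rewrite -pM !mulgV.
have pX x n : p (x ^+ n) = p x ^+ n.
  by elim: n => [|n IH]; rewrite ?expg0// !expgS pM IH.
have pk : commute (p h) c.2.
  have : commute (f h ^ c.1.2^-1) c.2.
    by apply/(@commuteJ _ _ _ c.1.2); rewrite -conjgM mulVg conjg1.
  rewrite -{2}fc.1; exact: gmulf_commute.
have [n [m [n0 nm]]] := full_commute_power cc fc (Std_proj _ _) pk.
case: nm => nm.
  exists (h ^+ n * g ^- m), n, (- m%:R)%R; split=> //.
  - move=> t; rewrite expoM expoV !expoX mulNr.
    by rewrite !mulr_natl.
  - by rewrite -/(p _) pM pV !pX nm /p ck mulgV.
  move=> D sD Dg Dh; have [D1 DM DV] := sD.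
  by apply: DM; [|apply: DV]; exact: subgroupX.
exists (h ^+ n * g ^+ m), n, m%:R%R; split=> //.
- by move=> t; rewrite expoM !expoX !mulr_natl.
- by rewrite -/(p _) pM !pX nm /p ck mulVg.
by move=> D sD Dg Dh; have [D1 DM DV] := sD; apply: DM; exact: subgroupX.
Qed.

Lemma commens_kill c d h : commens c d -> d \in fac (f h) ->
  proj (supp c) (f h ^ c.1.2^-1) <> 1.
Proof.
move=> [[e _] _] dh; rewrite /supp e => h1; apply: (kill_factor dh).
have -> : d.1.2^-1 = c.1.2^-1 * (c.1.2 * d.1.2^-1) by rewrite mulKg.
by rewrite conjgM projJ h1 conj1g.
Qed.

(* Gaussian elimination on the exponents of the irreducible factors: the pivot
   factor of the first vector is removed from all the others. *)
Lemma exists_separated T m s :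
    (forall t t', T t -> T t' -> t != t' -> adj t t') ->
    (forall i, (i < m)%N -> Std T (s i)) -> independent T m s ->
  exists s', [/\ forall i, (i < m)%N -> s' i <> 1,
      forall i j, (i < j < m)%N -> separates (s' i) (s' j)
    & forall D, subgroup D -> (forall i, (i < m)%N -> D (s i)) ->
        forall i, (i < m)%N -> D (s' i)].
Proof.
move=> cT; elim: m s => [|m IH] s sT s_ind; first by exists s; split=> // i j; lia.
have TC g h : Std T g -> Std T h -> commute g h.
  move=> Tg; apply: Std_commute_gen => t Tt; apply/commute_sym.
  apply: Std_commute_gen Tg => t' Tt'; have [->|tt'] := eqVneq t t'.
    exact: commute_refl.
  exact/commute_gen/cT.
have s01 : s 0%N <> 1.
  move=> s0; have := s_ind (fun i => (i == 0%N)%:R%R) _ 0%N isT.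
  suff sum0 : forall t, T t ->
      (\sum_(i < m.+1) (i == 0%N :> nat)%:R * expo t (s i) = 0)%R.
    by move/(_ sum0).
  move=> t _; rewrite big_ord_recl s0 expo1 mulr0 add0r big1// => i _.
  by rewrite mul0r.
have [c cs0] : exists c, c \in fac (f (s 0%N)).
  have [_ _ _ _ F0] := facP (f (s 0%N)).
  case e : (fac _) F0 => [|c F] F0; last by exists c; rewrite mem_head.
  by case: F0 => //; move=> fs0; apply: s01; apply: f_inj; rewrite fs0 gmul1.
have /choice[r rP] : forall i, exists r, (i < m)%N -> exists (n : nat) (e : int),
   [/\ (0 < n)%N,
    forall t, expo t r = (n%:R * expo t (s i.+1) + e * expo t (s 0%N))%R,
    proj (supp c) (f r ^ c.1.2^-1) = 1
  & forall D, subgroup D -> D (s 0%N) -> D (s i.+1) -> D r].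
  move=> i; have [im|] := boolP (i < m)%N; last by exists 1.
  have [//|r [n [e rne]]] := @eliminate c (s 0%N) (s i.+1) cs0 _.
    by apply: TC; exact: sT.
  by exists r => _; exists n, e.
have r_ind : independent T m r.
  move=> b b0.
  have /choice[ne neP] : forall i, exists ne : nat * int, (i < m)%N ->
     (0 < ne.1)%N /\ forall t,
       expo t (r i) = (ne.1%:R * expo t (s i.+1) + ne.2 * expo t (s 0%N))%R.
    move=> i; have [im|] := boolP (i < m)%N; last by exists (0%N, 0%R).
    by have [n [e [n0 re _ _]]] := rP i im; exists (n, e).
  (* A relation [b] among the [r i] expands to the relation [b'] among the [s i]. Independence gives
     [b j * n = 0] with [n] positive. *)
  pose b' i := if i is j.+1 then (b j * (ne j).1%:R)%R
    else (\sum_(i < m) b i * (ne i).2)%R.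
  have b'0 t : T t -> (\sum_(i < m.+1) b' i * expo t (s i) = 0)%R.
    move=> /b0 {2}<-; rewrite big_ord_recl mulr_suml -big_split /=.
    apply: eq_bigr => i _; have [_ ->] := neP i (ltn_ord i).
    by rewrite mulrDr !mulrA addrC.
  move=> i im; have /eqP := s_ind _ b'0 i.+1 im; rewrite /= mulf_eq0.
  have [n0 _] := neP i im.
  by rewrite [X in _ || X]Num.Theory.pnatr_eq0 eqn0Ngt n0 orbF => /eqP.
have rT i : (i < m)%N -> Std T (r i).
  move=> im; have [n [e [_ _ _]]] := rP i im; apply.
  - by split; [exact: Std1|exact: StdM|exact: StdV].
  - exact: sT.
  - exact: sT.
have [s' [s'1 s'sep s'D]] := IH r rT r_ind.
(* Having no [c] component is a subgroup condition, so it passes from the [r i] to the [s' i]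
   supplied by induction. *)
have kD : subgroup (fun g => proj (supp c) (f g ^ c.1.2^-1) = 1).
  split.
  - by rewrite gmul1 conj1g projg1.
  - by move=> g h g1 h1; rewrite gmulfM conjMg projM g1 h1 mulg1.
  - move=> g g1; apply: (@mulgI _ (proj (supp c) (f g ^ c.1.2^-1))).
    by rewrite -projM -conjMg -gmulfM mulgV gmul1 conj1g projg1 g1 mulg1.
have s'k i : (i < m)%N -> proj (supp c) (f (s' i) ^ c.1.2^-1) = 1.
  by move=> im; apply: (s'D _ kD) => // j jm; have [n [e []]] := rP j jm.
exists (fun i => if i is j.+1 then s' j else s 0%N); split.
- by case=> [|i] // im; exact: s'1.
- case=> [|i] [|j]//= ij; last by exact: s'sep.
  by exists c => // d dj cd; exact: commens_kill cd dj (s'k j ij).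
move=> D sD Ds; have Dr i : (i < m)%N -> D (r i).
  by move=> im; have [n [e [_ _ _]]] := rP i im; apply=> //; exact: Ds.
by case=> [|i] im; [exact: Ds|exact: s'D].
Qed.

End Elimination.

(** * The embedding into the clique graph *)

Section Twins.
Variable Lam : graph.
Implicit Types u v w t : Lam.

Definition star v : pred Lam := [pred u | (u == v) || adj u v].

Lemma star_sym v w : star v w = star w v.
Proof. by rewrite /star /= eq_sym adj_sym. Qed.

Definition twin v : pred Lam := [pred w | `[< star v =1 star w >]].

Lemma twinP v w : reflect (star v =1 star w) (twin v w).
Proof. exact: asboolP. Qed.

Lemma twin_refl v : twin v v.
Proof. exact/twinP. Qed.

Lemma twin_eq v w : twin v w -> twin v =1 twin w.
Proof.
move=> /twinP vw t; apply/twinP/twinP => [vt u|wt u]; first by rewrite -vw vt.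
by rewrite vw wt.
Qed.

Lemma twin_star v w t t' : twin v t -> twin w t' -> star v w = star t t'.
Proof. by move=> /twinP vt /twinP wt; rewrite vt star_sym wt star_sym. Qed.

Lemma twin_commute v w g h : star v w -> Std (twin v) g -> Std (twin w) h ->
  commute g h.
Proof.
move=> vw vg; apply: Std_commute_gen => t' wt'; apply/commute_sym.
apply: Std_commute_gen vg => t vt; move: vw; rewrite (twin_star vt wt') => /orP[/eqP ->|tt'].
  exact: commute_refl.
exact: commute_gen.
Qed.

End Twins.

(** * Representatives for twin vertices *)

Section Embedding.
Import GRing.Theory.
Variables (Lam Gam : graph) (f : {multiplicative raag Lam -> raag Gam}).
Hypotheses (finL : finite_graph Lam) (f_inj : injective f).
Local Notation x_ := (@raag_gen Lam).
Local Notation factor := ({fset Gam} * raag Gam * raag Gam)%type.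
Variable fac : raag Gam -> seq factor.
Hypothesis facP : forall g, factors_spec g (fac g).

(** Twins are pairwise adjacent and distinct generators have independent exponent vectors, so
    [exists_separated] applies to each twin class. *)
Lemma exists_representatives : exists beta : Lam -> raag Lam,
  [/\ forall v, Std (twin v) (beta v), forall v, beta v <> 1
    & forall v w, v != w -> twin v w ->
        separates f fac (beta v) (beta w) \/ separates f fac (beta w) (beta v)].
Proof.
have [E0 EE0] : exists E : seq Lam, [set: Lam]%classic = [set` E]%classic.
  exact/finite_seqP.
pose E := undup E0; have EP v : v \in E.
  by rewrite mem_undup; have : [set: Lam]%classic v by []; rewrite EE0.
pose s (T : seq Lam) i := nth 1 [seq x_ t | t <- T] i.
(* The choice depends on the list and not on a vertex, so twins draw from one and the same
   elimination. *)
have /choice[s' s'P] : forall T : seq Lam, exists s',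
    uniq T -> (forall t t', t \in T -> t' \in T -> t != t' -> adj t t') ->
    [/\ forall i, (i < size T)%N -> s' i <> 1,
      forall i j, (i < j < size T)%N -> separates f fac (s' i) (s' j)
    & forall D, subgroup D -> (forall i, (i < size T)%N -> D (s T i)) ->
        forall i, (i < size T)%N -> D (s' i)].
  move=> T; have [[uT cT]|nT] := pselect (uniq T /\
      forall t t', t \in T -> t' \in T -> t != t' -> adj t t'); last first.
    by exists (fun=> 1) => uT cT; case: nT.
  have sE i t0 : (i < size T)%N -> s T i = x_ (nth t0 T i).
    by move=> iT; rewrite /s (nth_map t0).
  have [| |s' s'P] := @exists_separated _ _ f f_inj fac facP [in T] (size T) (s T) cT.
  - move=> i iT; case: T iT sE {uT cT} => // t0 T iT sE.
    by rewrite (sE i t0)//; apply: Std_gen; exact: mem_nth.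
  - move=> c c0 i iT; case: T iT sE uT c0 {cT} => // t0 T iT sE uT c0.
    have := c0 (nth t0 (t0 :: T) i) (mem_nth _ iT).
    rewrite (bigD1 (Ordinal iT))//= big1 => [|j jNi].
      by rewrite addr0 (sE i t0)// expo_gen eqxx mulr1.
    by rewrite (sE j t0)// expo_gen nth_uniq// [_ == _](negbTE jNi) mulr0.
  by exists s'.
pose T v := [seq w <- E | twin v w].
have uT v : uniq (T v) by rewrite filter_uniq// undup_uniq.
have TE v w : (w \in T v) = twin v w by rewrite mem_filter EP andbT.
have cT v t t' : t \in T v -> t' \in T v -> t != t' -> adj t t'.
  rewrite !TE => vt vt' tt'; have := twin_star vt vt'.
  by rewrite /star /= eqxx eq_sym (negbTE tt') adj_sym /= adj_sym.
have Tv v : v \in T v by rewrite TE twin_refl.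
pose beta v := s' (T v) (index v (T v)).
have iT v : (index v (T v) < size (T v))%N by rewrite index_mem.
exists beta; split=> [v|v|v w vw tvw].
- have [_ _ sD] := s'P (T v) (uT v) (@cT v).
  apply: sD => //; first by split; [exact: Std1|exact: StdM|exact: StdV].
  move=> i iTv; rewrite /s (nth_map v)//; apply: Std_gen.
  by rewrite -TE mem_nth.
- by have [s1 _ _] := s'P (T v) (uT v) (@cT v); exact: s1.
have eT : T w = T v by apply: eq_filter => u; rewrite (twin_eq tvw).
have [_ sep _] := s'P (T v) (uT v) (@cT v).
have iwv : (index w (T v) < size (T v))%N by rewrite -eT.
rewrite /beta eT; have [ij|ji|ij] := ltngtP (index v (T v)) (index w (T v)).
- by left; apply: sep; rewrite ij.
- by right; apply: sep; rewrite ji iT.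
case/negP: vw; apply/eqP.
by rewrite -(nth_index v (Tv v)) ij nth_index// TE.
Qed.

End Embedding.

(** * Finite vertex sets of the extension graph and shared vertices *)

Section ExtensionCliques.
Variable Gam : graph.
Local Notation Ge := (extension_graph Gam).
Local Notation G := (raag Gam).

Lemma exists_fset_val (s : seq G) : (forall g, g \in s -> extension_vertices g) ->
  exists K : {fset Ge}, forall e : Ge, (e \in K) = (val e \in s).
Proof.
elim: s => [|g s IH] sP; first by exists fset0 => e; rewrite inE.
have [g' g's|K KP] := IH; first by apply: sP; rewrite inE g's orbT.
have gP : g \in @extension_vertices Gam by rewrite inE; exact/sP/mem_head.
exists ((exist _ g gP : Ge) |` K)%fset => e.
by rewrite !inE KP -(inj_eq val_inj).
Qed.

Lemma extension_adjE (e e' : Ge) :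
  adj e e' = (e != e') && `[< commute (val e) (val e') >].
Proof. by []. Qed.

(** Such a parabolic subgroup is abelian, so its support is complete as well as anticonnected. *)
Lemma par_commute_self (c : {fset Gam} * G * G) : pure c -> par_commute c c ->
  exists a, supp c = pred1 a.
Proof.
move=> pc cc; have [[[a ca] cA] _] := pc; exists a.
have comm v w : supp c v -> supp c w -> v != w -> adj w v.
  move=> cv cw vw; apply: gen_commuteE; first by rewrite eq_sym.
  apply/(@commuteJ _ _ _ c.1.2); apply: cc; rewrite /par -conjgM mulgV conjg1;
    exact: Std_gen.
apply/funext => v; apply/idP/eqP => [cv|-> //]; apply/eqP.
apply: (cA (pred1 a) _ _ v cv); first by exists a; rewrite /=.
move=> b c' cb /eqP -> cc' nac; apply: contraNT nac => nca.
by apply: comm => //.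
Qed.

(** If the parabolics commute, the common vertex centralizes both, and [vertex_spec] then makes each
    commute with itself. The supports are single vertices, equal by exponent sums, and the
    parabolics coincide. *)
Lemma vertex_inj (R : seq ({fset Gam} * G * G)) x c d :
    pure c -> pure d -> vertex_spec R x c -> vertex_spec R x d ->
    c \in R -> d \in R -> dep c d -> x c = x d -> commens c d.
Proof.
move=> pc pd [[v [k xv]] cx cR] [_ dx dR] Rc Rd [cd|//] xcd.
have ab_self c' : c' \in R -> vertex_spec R x c' ->
    (forall y, par c' y -> commute (x c') y) -> par_commute c' c'.
  move=> c'R [_ _ c'n] c'c; apply: contrapT => /(c'n _ c'R)[y c'y].
  by apply; exact: c'c.
have cc : par_commute c c.
  apply: ab_self => //; first by split=> //; exists v, k.
  by move=> y cy; rewrite xcd; apply/commute_sym/cd.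
have dd : par_commute d d.
  apply: ab_self => //; first by split=> //; rewrite -xcd; exists v, k.
  by move=> y dy; rewrite -xcd; exact: cd.
have [a ca] := par_commute_self pc cc; have [b db] := par_commute_self pd dd.
have suppE c' a' : supp c' = pred1 a' -> par c' (x c) -> a' = v.
  rewrite /par => -> /(expo_Std (t := v)); rewrite /= xv !expoJ expo_gen eqxx.
  by case: eqP => // _ /(_ isT).
have av := suppE _ _ ca cx; have bv : b = v by apply: suppE db _; rewrite xcd.
have fx : full (pred1 v) (x c ^ c.1.2^-1).
  split; first by rewrite -av -ca.
  move=> w wv; rewrite xv; do 2!apply: hyperbolicJ.
  exact: (full_gen v).2.
apply: same_par_commens => //; last by apply: cd; exact: par_elt.
split.
  apply/fsetP => w; rewrite -[w \in _]/(supp c w) -[w \in d.1.1]/(supp d w).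
  by rewrite ca db av bv.
rewrite ca av; apply/StdVE; rewrite invgM invgK; apply: (full_centralizer fx).
by rewrite -conjgM mulKg xcd -bv -db.
Qed.

End ExtensionCliques.

Theorem theorem3 (Lambda Gamma : graph)
    (finL : finite_graph Lambda) (finG : finite_graph Gamma) :
  embeds (raag Lambda) (raag Gamma) ->
  exists S : set (clique_graph (extension_graph Gamma)),
    isomorphic Lambda (induced_subgraph S).
Proof.
move=> [f f_inj]; have /choice[fac facP] := @exists_factors Gamma.
have [beta [bT b1 bsep]] := exists_representatives finL f_inj facP.
have [E EE] : exists E : seq Lambda, [set: Lambda]%classic = [set` E]%classic.
  exact/finite_seqP.
pose F v := fac (f (beta v)); pose R := flatten [seq F v | v <- E].
have FR v c : c \in F v -> c \in R.
  move=> cF; apply/flattenP; exists (F v) => //; apply: map_f.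
  by have : [set: Lambda]%classic v by []; rewrite EE.
have Fpure v c : c \in F v -> pure c.
  by have [Fp _ _ _ _] := facP (f (beta v)); exact: Fp.
have Rpure c : c \in R -> pure c by move=> /flattenP[_ /mapP[v _ ->]]; exact: Fpure.
have [x [xP xE xD]] := exists_vertices Rpure.
have /choice[K KP] : forall v, exists K : {fset extension_graph Gamma},
    forall e, (e \in K) = (val e \in [seq x c | c <- F v]).
  move=> v; apply: exists_fset_val => g /mapP[c /FR cR ->].
  by have [] := xP c cR.
have F0 v : exists c, c \in F v.
  have [_ _ _ _ Fn] := facP (f (beta v)); case e : (F v) => [|c l].
    case: Fn => // fb; apply: (b1 v); apply: f_inj.
    by rewrite fb gmul1.
  by exists c; rewrite mem_head.
have xK v c : c \in F v -> exists2 e, e \in K v & val e = x c.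
  move=> cF; have [xv _ _] := xP c (FR v c cF).
  have xin : x c \in @extension_vertices Gamma by rewrite inE.
  by exists (exist _ (x c) xin : extension_graph Gamma) => //; rewrite KP; apply: map_f.
have Fdep v w c d : star v w -> c \in F v -> d \in F w -> dep c d.
  move=> vw cF dF; apply: commute_dep; [exact: Fpure cF|exact: Fpure dF|].
  have [_ Fc _ _ _] := facP (f (beta v)); have [_ Fd _ _ _] := facP (f (beta w)).
  apply/commute_sym/(Fc _ _ cF)/commute_sym/(Fd _ _ dF); apply: gmulf_commute.
  exact: twin_commute vw (bT v) (bT w).
(* Otherwise a common exponent makes [f (beta w)] commute with a power of [f (beta v)]. Injectivity
   of [f] moves this to the source, where [Std_not_commute] on the two twin classes refutes it. *)
have FdepN v w : ~~ star v w -> exists c d, [/\ c \in F v, d \in F w & ~ dep c d].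
  move=> vw; apply: contrapT => nex.
  have Fd c d : c \in F v -> d \in F w -> dep c d.
    by move=> cF dF; apply: contrapT => ncd; apply: nex; exists c, d.
  have [_ _ Fv _ _] := facP (f (beta v)); have [_ _ Fw _ _] := facP (f (beta w)).
  have powers c d : c \in F v -> d \in F w ->
      exists2 N, (0 < N)%N & commute (elt c ^+ N) (elt d).
    move=> cF dF; have [cd|[_ [n [m [n0 _ cd]]]]] := Fd c d cF dF.
      by exists 1%N => //; apply: cd; apply: par_elt; [exact: Fpure cF|exact: Fpure dF].
    exists n => //; case: cd => ->; last apply: commuteVl;
      exact/commute_sym/commuteX/commute_refl.
  have commX (g h : raag Gamma) n m : commute (g ^+ n) h -> commute (g ^+ (n * m)) h.
    by move=> gh; rewrite expgnA; apply/commute_sym/commuteX/commute_sym.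
  have common (s : seq ({fset Gamma} * raag Gamma * raag Gamma)) c :
      {subset s <= F w} -> c \in F v ->
      exists2 N, (0 < N)%N & forall d, d \in s -> commute (elt c ^+ N) (elt d).
    elim: s => [|d s IH] sF cF; first by exists 1%N.
    have [d' d's|N N0 NP] := IH _ cF; first by apply: sF; rewrite inE d's orbT.
    have [M M0 MP] := powers c d cF (sF d (mem_head _ _)).
    exists (N * M)%N; rewrite ?muln_gt0 ?N0// => d'; rewrite inE => /orP[/eqP ->|/NP cd'].
      by rewrite mulnC; exact: commX.
    exact: commX.
  have common2 (s : seq ({fset Gamma} * raag Gamma * raag Gamma)) :
      {subset s <= F v} ->
      exists2 N, (0 < N)%N &
        forall c, c \in s -> commute (elt c ^+ N) (f (beta w)).
    elim: s => [|c s IH] sF; first by exists 1%N.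
    have [c' c's|N N0 NP] := IH; first by apply: sF; rewrite inE c's orbT.
    have [M M0 MP] := common (F w) c (fun _ => id) (sF c (mem_head _ _)).
    exists (N * M)%N; rewrite ?muln_gt0 ?N0// => c'; rewrite inE => /orP[/eqP ->|/NP cc'].
      rewrite mulnC; apply: commX; rewrite -[f _]expg1; apply: Fw => d dF.
      exact: MP.
    exact: commX.
  have [N N0 NP] := common2 (F v) (fun _ => id).
  have : commute (f (beta w)) (f (beta v) ^+ N).
    by apply: Fv => c cF; apply/commute_sym/NP.
  have -> : f (beta v) ^+ N = f (beta v ^+ N) by rewrite gmul_expg.
  move=> fc; have : commute (beta w) (beta v ^+ N).
    by apply: f_inj; rewrite !gmulfM.
  apply: (Std_not_commute N0 _ (bT v) (bT w) (b1 v) (b1 w)) => t t' vt wt'.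
  by apply/andP; rewrite -negb_or -[_ || _]/(star t' t) star_sym -(twin_star vt wt').
have Kcomm v w : star v w <->
    forall e e', e \in K v -> e' \in K w -> commute (val e) (val e').
  split=> [vw e e'|comm].
    rewrite !KP => /mapP[c cF ->] /mapP[d dF ->].
    have [cR dR] := (FR v c cF, FR w d dF).
    have [cd|cd] := Fdep v w c d vw cF dF.
      by apply: cd; [have [] := xP c cR|have [] := xP d dR].
    by rewrite (xE c d)//; exact: commute_refl.
  apply: contrapT => /negP/FdepN[c [d [cF dF ncd]]].
  have [e eK ec] := xK v c cF; have [e' eK' ed] := xK w d dF.
  by apply: (xD c d (FR v c cF) (FR w d dF) ncd); rewrite -ec -ed; exact: comm.
(* By [Kcomm] the clique determines the star, so equal cliques come from twins. A separating factor
   would share its vertex with a factor of the other twin and be commensurable with it by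
   [vertex_inj]. *)
have Kinj v w : K v = K w -> v = w.
  move=> Kvw; have tvw : twin v w.
    apply/twinP => u; apply/idP/idP => /=; rewrite -/(star _ u) !(star_sym _ u).
      by move=> /Kcomm; rewrite Kvw => /Kcomm.
    by move=> /Kcomm; rewrite -Kvw => /Kcomm.
  apply/eqP; apply: contrapT => /negP vw.
  wlog [c cF cd] : v w Kvw tvw vw / separates f fac (beta v) (beta w).
    move=> wl; have [] := bsep v w vw tvw; first exact: wl.
    apply: wl => //; last by rewrite eq_sym.
    by rewrite -(twin_eq tvw) twin_refl.
  have [e] := xK v c cF; rewrite Kvw KP => /mapP[d dF ->] xdc.
  have [cR dR] := (FR v c cF, FR w d dF).
  apply: (cd d dF); apply: (vertex_inj (Rpure c cR) (Rpure d dR) (xP c cR) (xP d dR)) => //.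
  apply: Fdep cF dF; rewrite (twin_star tvw (twin_refl w)).
  by rewrite /star /= eqxx.
have Kclique v : K v \in @clique_vertices (extension_graph Gamma).
  rewrite inE; split.
    have [c cF] := F0 v; have [e eK _] := xK v c cF.
    by apply: contraTneq eK => ->; rewrite inE.
  move=> e e' eK eK' ee'; rewrite extension_adjE ee'; apply/asboolP.
  have /Kcomm : star v v by rewrite /star /= eqxx.
  by apply.
pose phi v : clique_graph (extension_graph Gamma) := exist _ (K v) (Kclique v).
have phi_inj : injective phi by move=> v w /(congr1 val)/= /Kinj.
have phi_adj v w : adj (phi v) (phi w) = adj v w.
  rewrite [LHS]/(clique_adj _ _) /clique_adj /= (inj_eq phi_inj).
  have [->|vw] := eqVneq v w; first by rewrite adj_irr.
  rewrite /=; apply/asboolP/idP => [[C [CC vC wC]]|avw].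
    have /Kcomm : forall e e', e \in K v -> e' \in K w -> commute (val e) (val e').
      move=> e e' eK eK'; have [->|ee'] := eqVneq e e'; first exact: commute_refl.
      have := CC e e' (vC _ eK) (wC _ eK') ee'.
      by rewrite extension_adjE => /andP[_ /asboolP].
    by rewrite /star /= eq_sym (negbTE vw) adj_sym.
  (* The union of the two cliques is complete, because [star] holds for every pair among [v] and
     [w]. *)
  exists [set e | e \in K v \/ e \in K w]%classic; split=> [|e|e] /=; [|by left|by right].
  have comm u u' : u \in [:: v; w] -> u' \in [:: v; w] -> star u u'.
    rewrite !inE /star /= => /orP[] /eqP -> /orP[] /eqP ->; rewrite ?eqxx// ?avw ?orbT//.
    by rewrite adj_sym avw orbT.
  move=> e e' ee ee' nee'; rewrite extension_adjE nee'; apply/asboolP.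
  have [vin win] : v \in [:: v; w] /\ w \in [:: v; w] by rewrite !inE !eqxx orbT.
  have cK u u' : u \in [:: v; w] -> u' \in [:: v; w] -> e \in K u -> e' \in K u' ->
      commute (val e) (val e').
    by move=> uin u'in; apply: (proj1 (Kcomm u u')); exact: comm.
  by case: ee => eK; case: ee' => eK'; exact: (cK _ _ _ _ eK eK').
exists (range phi)%classic.
have phiR v : phi v \in range phi by rewrite inE; exists v.
exists (fun v => exist _ (phi v) (phiR v)); last first.
  by move=> v w; rewrite -phi_adj.
have psiP (y : induced_subgraph (range phi)%classic) : exists v, phi v = val y.
  by have := valP y; rewrite inE => -[v _ <-]; exists v.
have /choice[psi psiE] := psiP.
exists psi => [v|y]; first by apply: phi_inj; rewrite psiE.
by apply: val_inj; rewrite /= psiE.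
Qed.
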